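(* Let $D$ be a weighted oriented graph which has at most two unbalanced cycles and is such that (i) if $D$ has exactly two unbalanced cycles connected by a path $P$, then no balanced cycle in $D$ shares an edge with the path $P$; (ii) no two (distinct) balanced cycles in $D$ share a path. Then $Gr_D=\mathcal C_D$. Moreover, $I_D$ is strongly robust.
   Context: $K$ is a field. A weighted oriented graph $D=(V(D),E(D),\mathbf w)$ is a finite graph without loops or parallel edges on $V(D)=\{x_1,\dots,x_n\}$, each edge being given an orientation ($(x_i,x_j)$ denotes an edge from $x_i$ to $x_j$), together with a weight function $\mathbf w:V(D)\to\{1,2,\dots\}$; put $w_i=\mathbf w(x_i)$. Write $E(D)=\{e_1,\dots,e_m\}$. The incidence matrix $A(D)$ is the $n\times m$ matrix whose $(i,j)$ entry is $1$ if $e_j=(x_i,x_l)$ for some $l$, $w_i$ if $e_j=(x_l,x_i)$ for some $l$, and $0$ otherwise. The toric ideal $I_D$ is the kernel of the $K$-algebra homomorphism $K[e_1,\dots,e_m]\to K[x_1,\dots,x_n]$ sending $e_j=(x_i,x_l)$ to $x_ix_l^{w_l}$. Binomials are identified up to sign. A nonzero binomial $\mathbf e^{\mathbf u}-\mathbf e^{\mathbf v}\in I_D$ is primitive if there is no other nonzero binomial $\mathbf e^{\mathbf u'}-\mathbf e^{\mathbf v'}\in I_D$ with $\mathbf e^{\mathbf u'}\mid\mathbf e^{\mathbf u}$ and $\mathbf e^{\mathbf v'}\mid\mathbf e^{\mathbf v}$. The Graver basis $Gr_D$ is the set of primitive binomials of $I_D$. The set $\mathcal C_D$ of circuit binomials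 consists of the irreducible nonzero binomials of $I_D$ whose support (set of variables occurring) is minimal with respect to inclusion among supports of nonzero binomials in $I_D$. $I_D$ is strongly robust if $Gr_D$ is a minimal generating set of $I_D$. Cycles and paths in $D$ are those of the underlying undirected graph, with the inherited orientations and weights. An (even) cycle $\mathcal C$ is balanced if $\det A(\mathcal C)=0$; a cycle that is not balanced is unbalanced (odd cycles always have nonzero determinant). Two cycles are connected by a path $P$ if they are vertex-disjoint and $P$ is a path of length $\ge1$ meeting their union exactly in its two endpoints, one on each cycle. Two cycles share a path if they contain a common path of length $\ge1$. *)

(* Defs.v *)
From HB Require Import structures.
From mathcomp Require Import all_boot all_order all_algebra.
From mathcomp Require Export mpoly.

Set Implicit Arguments.
Unset Strict Implicit.
Unset Printing Implicit Defensive.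

Import GRing.Theory.
Local Open Scope ring_scope.

(* Edge [j] is the ordered pair [(src j, tgt j)].  Injectivity of the set of
   endpoints excludes parallel edges as well as antiparallel ones: the
   underlying undirected graph is simple. *)
Record wograph (n m : nat) := WOGraph {
  src : 'I_m -> 'I_n;
  tgt : 'I_m -> 'I_n;
  wt : 'I_n -> nat;
  no_loop : forall j, src j != tgt j;
  no_parallel : injective (fun j => [set src j; tgt j]);
  wt_gt0 : forall i, (0 < wt i)%N
}.

Section Graph.
Variables (n m : nat) (D : wograph n m).

Definition incidence : 'M[int]_(n, m) :=
  \matrix_(i, j) (if i == src D j then 1
                  else if i == tgt D j then (wt D i)%:Z else 0).

Definition endpoints (j : 'I_m) : {set 'I_n} := [set src D j; tgt D j].

(* Paths of length at least 1 and cycles have no isolated vertices, so as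
   subgraphs they are determined by, and represented by, their edge sets. *)
Definition vertices (S : {set 'I_m}) : {set 'I_n} := \bigcup_(j in S) endpoints j.

(* [v] and [e] list the vertices and edges of the cycle [C] in cyclic order;
   [ordS] is the cyclic successor. *)
Definition cycle_listing (C : {set 'I_m}) (k : nat)
    (v : 'I_k -> 'I_n) (e : 'I_k -> 'I_m) : Prop :=
  [/\ (2 < k)%N, injective v,
      forall i, endpoints (e i) = [set v i; v (ordS i)]
    & C = [set e i | i : 'I_k]].

Definition is_cycle (C : {set 'I_m}) : Prop :=
  exists k (v : 'I_k -> 'I_n) (e : 'I_k -> 'I_m), cycle_listing C v e.

(* The matrix is the incidence matrix of the cycle for the given ordering of
   its vertices and edges; other orderings change the determinant at most by
   a sign, so the existential choice is harmless. *)
Definition balanced_cycle (C : {set 'I_m}) : Prop :=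
  exists k (v : 'I_k -> 'I_n) (e : 'I_k -> 'I_m),
    cycle_listing C v e /\ \det (mxsub v e incidence) = 0.

Definition unbalanced_cycle (C : {set 'I_m}) : Prop :=
  is_cycle C /\ ~ balanced_cycle C.

(* Path of length at least 1 from [x] to [y], with distinct vertices. *)
Definition is_path (P : {set 'I_m}) (x y : 'I_n) : Prop :=
  exists k (v : 'I_k.+1 -> 'I_n) (e : 'I_k -> 'I_m),
    [/\ (0 < k)%N, injective v,
        forall i, endpoints (e i) = [set v (widen_ord (leqnSn k) i); v (lift ord0 i)],
        P = [set e i | i : 'I_k]
      & v ord0 = x /\ v ord_max = y].

Definition connects (P C1 C2 : {set 'I_m}) : Prop :=
  [disjoint vertices C1 & vertices C2] /\
  exists x y, [/\ is_path P x y, x \in vertices C1, y \in vertices C2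
    & vertices P :&: (vertices C1 :|: vertices C2) = [set x; y]].

Definition share_edge (S T : {set 'I_m}) : Prop := exists j, j \in S /\ j \in T.

Definition share_path (C1 C2 : {set 'I_m}) : Prop :=
  exists P x y, [/\ is_path P x y, P \subset C1 & P \subset C2].

Definition at_most_two_unbalanced : Prop :=
  forall C1 C2 C3, unbalanced_cycle C1 -> unbalanced_cycle C2 ->
    unbalanced_cycle C3 -> [\/ C1 = C2, C1 = C3 | C2 = C3].

Definition exactly_two_unbalanced (C1 C2 : {set 'I_m}) : Prop :=
  C1 <> C2 /\ (forall C, unbalanced_cycle C <-> C = C1 \/ C = C2).

End Graph.

Section ToricIdeal.
Variables (K : fieldType) (n m : nat) (D : wograph n m).

Definition edge_monomial (j : 'I_m) : {mpoly K[n]} :=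
  'X_(src D j) * 'X_(tgt D j) ^+ wt D (tgt D j).

Definition toric_ideal (p : {mpoly K[m]}) : Prop :=
  p \mPo [tuple edge_monomial j | j < m] = 0.

Definition binomial (u v : 'X_{1..m}) : {mpoly K[m]} := 'X_[u] - 'X_[v].

Definition toric_binomial (u v : 'X_{1..m}) : Prop :=
  binomial u v <> 0 /\ toric_ideal (binomial u v).

Definition eq_up_to_sign (p q : {mpoly K[m]}) : Prop := p = q \/ p = - q.

(* On multi-exponents [(u' <= u)%MM] is the componentwise order, that is,
   divisibility of the monomials. *)
Definition primitive (u v : 'X_{1..m}) : Prop :=
  toric_binomial u v /\
  forall u' v', toric_binomial u' v' -> (u' <= u)%MM -> (v' <= v)%MM ->
    eq_up_to_sign (binomial u' v') (binomial u v).

(* Sets of binomials up to sign are represented by sets of polynomials that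
   are closed under negation. *)
Definition graver (p : {mpoly K[m]}) : Prop :=
  exists u v, p = binomial u v /\ primitive u v.

Definition supp_vars (p : {mpoly K[m]}) : {set 'I_m} :=
  [set j | has (fun u : 'X_{1..m} => u j != 0%N) (msupp p)].

Definition irreducible_mpoly (p : {mpoly K[m]}) : Prop :=
  [/\ p <> 0, p \isn't a GRing.unit
    & forall q r, p = q * r -> q \is a GRing.unit \/ r \is a GRing.unit].

Definition circuit (p : {mpoly K[m]}) : Prop :=
  exists u v, [/\ p = binomial u v, toric_binomial u v, irreducible_mpoly p
    & forall u' v', toric_binomial u' v' ->
        supp_vars (binomial u' v') \subset supp_vars p ->
        supp_vars (binomial u' v') = supp_vars p].

Definition generated_ideal (S : {mpoly K[m]} -> Prop) (p : {mpoly K[m]}) : Prop :=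
  exists s : seq ({mpoly K[m]} * {mpoly K[m]}),
    (forall x, x \in s -> S x.2) /\ p = \sum_(x <- s) x.1 * x.2.

Definition generates (S I : {mpoly K[m]} -> Prop) : Prop :=
  forall p, generated_ideal S p <-> I p.

(* Minimality with respect to inclusion, elements being identified up to sign:
   only subsets closed under negation compete. *)
Definition minimal_generating_set (S I : {mpoly K[m]} -> Prop) : Prop :=
  generates S I /\
  forall T : {mpoly K[m]} -> Prop,
    (forall p, T p -> S p) -> (forall p, T p -> T (- p)) ->
    generates T I -> forall p, S p -> T p.

Definition strongly_robust : Prop := minimal_generating_set graver toric_ideal.

End ToricIdeal.

(* Main.v *)
From HB Require Import structures.
From mathcomp Require Import all_boot all_order all_algebra.
From mathcomp Require Import ring zify.
From Stdlib Require Import Classical.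
Require Import Defs.

(** The exponent differences of the binomials of [I_D] form the kernel [L] of
    the incidence matrix.  The support of a vector of minimal support in [L] has
    no leaf, so an edge of it lying on none of its cycles is a bridge between two
    disjoint cycles.  Hence such a support either is a balanced cycle, or contains
    both unbalanced cycles [C1], [C2], and by (i) each of its edges lying on a
    balanced cycle is in [C1] or [C2].  Eliminating a common edge, one deduces
    with (ii) that minimal supports are pairwise disjoint or equal.  Then [L] is a
    direct sum of lines with disjoint supports, so that primitive vectors are the
    generators of these lines; two primitive binomials are equal up to sign as
    soon as a monomial of one meets a monomial of the other, which makes every
    primitive binomial indispensable. *)

Set Implicit Arguments.
Unset Strict Implicit.
Unset Printing Implicit Defensive.

Import Order.TTheory GRing.Theory Num.Theory.
Local Open Scope ring_scope.

(** * Leafless graphs *)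

(** A simple path starting at [b] is extended at its free end, never stepping straight back, until
    the new vertex falls on the path. This closes a cycle through [c], and the rest is the tail [t],
    possibly empty, back to [b]. *)
Lemma lollipop (T : finType) (e : rel T) (b : T) :
    ssrbool.symmetric e -> irreflexive e -> (exists y, e b y) ->
    (forall x y, connect e b x -> x != b -> e x y -> exists2 z, z != y & e x z) ->
  exists c s t, [/\ (1 < size s)%N, uniq (s ++ c :: t), cycle e (c :: s),
    path e c t & last c t = b].
Proof.
move=> e_sym e_irr [y0 eby0] ext.
(* The growing path is listed from its newest vertex [x] down to [b]; [k] is fuel for the extensions
   left. *)
suff grow k x y t : (#|T| - size t <= k)%N -> uniq (x :: y :: t) ->
    path e x (y :: t) -> last y t = b ->
  exists c s t, [/\ (1 < size s)%N, uniq (s ++ c :: t), cycle e (c :: s),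
    path e c t & last c t = b].
  apply: (grow #|T| y0 b [::]) => //=; first by rewrite leq_subr.
  - by rewrite inE andbT; apply: contraTneq eby0 => ->; rewrite e_irr.
  - by rewrite e_sym eby0.
elim: k x y t => [|k IHk] x y t le_k Uw ew lastw.
  have := max_card (mem (x :: y :: t)); rewrite (card_uniqP Uw) /= => ltT.
  by move: le_k; rewrite leqn0 subn_eq0 leqNgt ltnW.
have xb : x != b.
  have : b \in y :: t by rewrite -lastw mem_last.
  by apply: contraTneq => <-; case/andP: Uw.
have bx : connect e b x.
  by rewrite (sym_connect_sym e_sym); apply/connectP; exists (y :: t).
have exy : e x y by case/andP: ew.
have [z zy exz] := ext x y bx xb exy.
have zx : z != x by apply: contraTneq exz => ->; rewrite e_irr.
have [zt|zt] := boolP (z \in t).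
  case/splitPr: zt le_k Uw ew lastw => t1 t2 _ Uw ew lastw.
  exists z, [:: x, y & t1], t2; split=> //=.
  - move: ew; rewrite /= cat_path /= => /and4P[_ p1 pz _].
    by rewrite e_sym exz exy rcons_path p1 pz.
  - by move: ew; rewrite /= cat_path /= => /and4P[].
  - by move: lastw; rewrite last_cat.
have Uw' : uniq [:: z, x, y & t].
  by rewrite cons_uniq Uw !inE !negb_or zx zy zt.
apply: (IHk z x (y :: t)) => //=.
- by move: le_k; rewrite /= !leq_subLR addnS addSn.
- by rewrite e_sym exz.
Qed.

Section Graph.
Variables (n m : nat) (D : wograph n m).
Implicit Types (S C P : {set 'I_m}) (x y a b : 'I_n) (j : 'I_m).

Definition adj S : rel 'I_n :=
  fun x y => [exists j in S, endpoints D j == [set x; y]].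

Lemma card_endpoints j : #|endpoints D j| = 2.
Proof. by rewrite cards2 no_loop. Qed.

Lemma endpoints_neq j x y : endpoints D j = [set x; y] -> x != y.
Proof.
by move=> jxy; have := card_endpoints j; rewrite jxy cards2; case: (x != y).
Qed.

Lemma endpoints_other j x : x \in endpoints D j ->
  exists y, endpoints D j = [set x; y].
Proof.
rewrite !inE => /orP[] /eqP ->; first by exists (tgt D j).
by exists (src D j); rewrite setUC.
Qed.

Lemma endpoints_inj : injective (endpoints D).
Proof. exact: no_parallel. Qed.

Lemma adj_sym S : ssrbool.symmetric (adj S).
Proof. by move=> x y; apply: eq_existsb => j; rewrite [[set x; y]]setUC. Qed.

Lemma adj_irr S : irreflexive (adj S).
Proof.
move=> x; apply/existsP => -[j /andP[_ /eqP /endpoints_neq]].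
by rewrite eqxx.
Qed.

Lemma adjP S x y :
  reflect (exists2 j, j \in S & endpoints D j = [set x; y]) (adj S x y).
Proof.
apply: (iffP existsP) => [[j /andP[jS /eqP]]|[j jS jxy]]; exists j => //.
by rewrite jS jxy /=.
Qed.

(** Passes from cyclic vertex sequences to cycles as edge sets. The last conclusion locates the
    closing edge, by which [bridge_connects] turns a path into a cycle. *)
Lemma seq_cycle S (s : seq 'I_n) :
    (2 < size s)%N -> uniq s -> cycle (adj S) s ->
  exists C, [/\ is_cycle D C, C \subset S, vertices D C = [set x in s] &
    forall x0 j, endpoints D j = [set last x0 s; head x0 s] -> j \in C].
Proof.
case: s => // x0 p; set s := x0 :: p => size_s Us cyc.
pose k := size s; pose v (i : 'I_k) := nth x0 s i.
(* [rcons p x0] is [s] rotated by one place, so it lists the cyclic successors. *)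
have v_next (i : 'I_k) : v (ordS i) = nth x0 (rcons p x0) i.
  rewrite /v nth_rcons /=; have : (i < (size p).+1)%N := ltn_ord i.
  rewrite ltnS leq_eqVlt => /predU1P[->|lt_i].
    by rewrite modnn ltnn eqxx.
  by rewrite modn_small // lt_i.
have v_adj i : exists j, (j \in S) && (endpoints D j == [set v i; v (ordS i)]).
  apply/existsP; rewrite -/(adj S _ _) v_next.
  have /(pathP x0)/(_ i) := cyc; rewrite size_rcons ltn_ord => /(_ isT).
  by rewrite -rcons_cons nth_rcons ltn_ord.
have [e eP] := fin_all_exists v_adj.
have eE i : endpoints D (e i) = [set v i; v (ordS i)].
  by case/andP: (eP i) => _ /eqP.
have v_inj : injective v.
  by move=> i j /eqP; rewrite nth_uniq // => /eqP /val_inj.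
exists [set e i | i : 'I_k]; split.
- by exists k, v, e; split.
- by apply/subsetP => _ /imsetP[i _ ->]; case/andP: (eP i).
- apply/setP => x; rewrite inE; apply/bigcupP/idP.
    case=> _ /imsetP[i _ ->]; rewrite eE in_set2.
    by case/orP=> /eqP ->; apply: mem_nth.
  move=> xs; have ltx : (index x s < k)%N by rewrite index_mem.
  exists (e (Ordinal ltx)); first exact: imset_f.
  by rewrite eE !inE /v /= nth_index ?eqxx.
- move=> y0 j jE; pose i : 'I_k := Ordinal (ltnSn (size p)).
  suff -> : j = e i by apply: imset_f.
  apply: endpoints_inj; rewrite jE eE v_next nth_rcons ltnn eqxx /=.
  by rewrite /v /= -[size p]/((size s).-1) nth_last /=.
Qed.

(** The last conclusion holds because the graph is simple: two consecutive vertices determine the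
    edge joining them. It serves to find the bridge on the connecting path. *)
Lemma seq_path S (x : 'I_n) (s : seq 'I_n) :
    s != [::] -> uniq (x :: s) -> path (adj S) x s ->
  exists P, [/\ is_path D P x (last x s), P \subset S,
    vertices D P = [set y in x :: s] &
    forall s1 a b s2 j, x :: s = s1 ++ [:: a, b & s2] ->
      endpoints D j = [set a; b] -> j \in P].
Proof.
move=> s0 Us xs; pose k := size s; pose v (i : 'I_k.+1) := nth x (x :: s) i.
have v_adj (i : 'I_k) : exists j, (j \in S) &&
    (endpoints D j == [set v (widen_ord (leqnSn k) i); v (lift ord0 i)]).
  apply/existsP; rewrite -/(adj S _ _).
  by have /(pathP x)/(_ i (ltn_ord i)) := xs.
have [e eP] := fin_all_exists v_adj.
have eE i : endpoints D (e i) =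
    [set v (widen_ord (leqnSn k) i); v (lift ord0 i)].
  by case/andP: (eP i) => _ /eqP.
have v_inj : injective v.
  by move=> i j /eqP; rewrite nth_uniq // => /eqP /val_inj.
exists [set e i | i : 'I_k]; split.
- exists k, v, e; split=> //; first by rewrite lt0n size_eq0.
  by split=> //; rewrite /v /= -[k]/((size (x :: s)).-1) nth_last.
- by apply/subsetP => _ /imsetP[i _ ->]; case/andP: (eP i).
- apply/setP => y; rewrite inE; apply/bigcupP/idP.
    case=> _ /imsetP[i _ ->]; rewrite eE in_set2.
    by case/orP=> /eqP ->; apply: mem_nth; rewrite /= ltnS // ltnW.
  rewrite inE => /predU1P[->|ys].
    have k0 : (0 < k)%N by rewrite lt0n size_eq0.
    exists (e (Ordinal k0)); first exact: imset_f.
    by rewrite eE !inE /v eqxx.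
  have lty : (index y s < k)%N by rewrite index_mem.
  exists (e (Ordinal lty)); first exact: imset_f.
  by rewrite eE !inE /v /= nth_index ?eqxx ?orbT.
- move=> s1 a b s2 j sE jE.
  have lt1 : (size s1 < k)%N.
    by rewrite -ltnS -[k.+1]/(size (x :: s)) sE size_cat /= !addnS !ltnS leq_addr.
  suff -> : j = e (Ordinal lt1) by apply: imset_f.
  apply: endpoints_inj; rewrite jE eE /v /= -[nth x s _]/(nth x (x :: s) _.+1) sE.
  by rewrite !nth_cat ltnn subnn ltnNge leqnSn /= subSnn.
Qed.

Definition no_leaf S := forall x j, j \in S -> x \in endpoints D j ->
  exists j', [/\ j' \in S, j' != j & x \in endpoints D j'].

(** Without [j] its two ends are separated in [S], since a path between them would close up through
    [j]. The absence of leaves lets a lollipop grow from each end; the two lie in different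
    components, and their tails joined by [j] form the connecting path. *)
Lemma bridge_connects S j : no_leaf S -> j \in S ->
    (forall C, is_cycle D C -> C \subset S -> j \notin C) ->
  exists C1 C2 P, [/\ is_cycle D C1 /\ C1 \subset S, is_cycle D C2 /\ C2 \subset S,
    connects D P C1 C2 & j \in P].
Proof.
move=> nlS jS bridge; pose e := adj (S :\ j).
pose a := src D j; pose b := tgt D j; have jab : endpoints D j = [set a; b] by [].
have ab : a != b by apply: no_loop.
have e_sym : ssrbool.symmetric e := adj_sym _.
have e_irr : irreflexive e := adj_irr _.
have sub_adj : subrel e (adj S).
  move=> x y /adjP[i iS iE]; apply/adjP; exists i => //.
  by move: iS; rewrite inE => /andP[].
have not_ab : ~~ connect e a b.
  apply/negP => /connectP[p0 ep0 lastp0].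
  case: (shortenP ep0) lastp0 => p ep Up _ lastp.
  have [C [cycC sCS _ /(_ a j)]] : exists C, [/\ is_cycle D C, C \subset S,
      vertices D C = [set x in a :: p] &
      forall x0 j, endpoints D j = [set last x0 (a :: p); head x0 (a :: p)] ->
        j \in C].
    apply: seq_cycle => //=.
      case: p lastp ep {Up} => [|x [|y p]] //=.
        by move=> /eqP; rewrite eq_sym (negPf ab).
      move=> <-; rewrite andbT => /adjP[i].
      by rewrite !inE -jab => /andP[ij _] /endpoints_inj iE; rewrite iE eqxx in ij.
    rewrite rcons_path (sub_path sub_adj ep) -lastp /=.
    by apply/adjP; exists j => //; rewrite jab setUC.
  rewrite /= -lastp jab setUC => /(_ erefl) jC.
  by have := bridge C cycC sCS; rewrite jC.
(* The second edge that [no_leaf] provides at [x] is not [j]: of the ends of [j], [c] is excluded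
   and [d] is out of reach. *)
have extend c d x y : endpoints D j = [set c; d] -> ~~ connect e c d ->
    connect e c x -> x != c -> e x y -> exists2 z, z != y & e x z.
  move=> jcd not_cd cx xc /adjP[i]; rewrite !inE => /andP[_ iS] iE.
  have [|i' [i'S i'i xi']] := nlS x i iS; first by rewrite iE !inE eqxx.
  have [z i'E] := endpoints_other xi'; exists z.
    by apply: contraNneq i'i => zy; apply/eqP/endpoints_inj; rewrite iE i'E zy.
  apply/adjP; exists i' => //; rewrite !inE i'S andbT.
  apply: contraTneq xi' => ->; rewrite jcd !inE negb_or xc /=.
  by apply: contraNneq not_cd => <-.
have start c d : endpoints D j = [set c; d] -> exists y, e c y.
  move=> jcd; have [|i [iS ij ci]] := nlS c j jS; first by rewrite jcd !inE eqxx.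
  have [y iE] := endpoints_other ci; exists y.
  by apply/adjP; exists i => //; rewrite !inE ij.
have [ca [sa [ta [size_sa Ua cyca patha lasta]]]] :=
  lollipop e_sym e_irr (start a b jab) (fun x y => extend a b x y jab not_ab).
have jba : endpoints D j = [set b; a] by rewrite jab setUC.
have not_ba : ~~ connect e b a by rewrite (sym_connect_sym e_sym).
have [cb [sb [tb [size_sb Ub cycb pathb lastb]]]] :=
  lollipop e_sym e_irr (start b a jba) (fun x y => extend b a x y jba not_ba).
have [U1 U2] : uniq (ca :: sa) /\ uniq (cb :: sb).
  move: Ua Ub; rewrite !cat_uniq !cons_uniq => /and3P[-> + _] /and3P[-> + _].
  by rewrite /= !negb_or => /andP[-> _] /andP[-> _].
have [C1 [cycC1 sC1 vC1 _]] := seq_cycle (S := S) (s := ca :: sa)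
  size_sa U1 (sub_cycle sub_adj cyca).
have [C2 [cycC2 sC2 vC2 _]] := seq_cycle (S := S) (s := cb :: sb)
  size_sb U2 (sub_cycle sub_adj cycb).
have conn c d s t : path e c t -> last c t = d -> cycle e (c :: s) ->
    {in s ++ c :: t, forall x, connect e d x}.
  move=> pt lt cyc x; rewrite mem_cat => xst.
  have cd : connect e c d by apply/connectP; exists t.
  rewrite (sym_connect_sym e_sym).
  have [xct|xct] := boolP (x \in c :: t).
    move: xct; rewrite inE => /predU1P[-> //|xt].
    case/splitPr: xt pt lt => t1 t2.
    rewrite cat_path last_cat => /= /and3P[_ _ pt2] lt.
    by apply/connectP; exists t2.
  move: xst; rewrite (negPf xct) orbF => xs.
  apply: connect_trans cd; move: cyc; case/splitPr: xs => s1 s2.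
  rewrite /= rcons_cat cat_path rcons_cons /= => /and3P[_ _ p2].
  by apply/connectP; exists (rcons s2 c); rewrite ?last_rcons.
have conna := conn _ _ _ _ patha lasta cyca.
have connb := conn _ _ _ _ pathb lastb cycb.
have disj x : x \in sa ++ ca :: ta -> x \in sb ++ cb :: tb -> False.
  move=> /conna ax /connb; rewrite (sym_connect_sym e_sym) => xb.
  by case/negP: not_ab; apply: connect_trans ax xb.
(* [ca :: q] follows the first tail to [a], crosses [j] to [b] and goes back along the second tail
   to [cb]. *)
pose q := ta ++ rev (cb :: tb).
have lastq : last ca q = cb by rewrite last_cat rev_cons last_rcons.
have Uq : uniq (ca :: q).
  rewrite -cat_cons cat_uniq rev_uniq.
  move: (Ua) (Ub); rewrite !cat_uniq => /and3P[_ _ ->] /and3P[_ _ ->].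
  rewrite andbT /=; apply/hasPn => x; rewrite mem_rev => xb; apply/negP => xa.
  by apply: (@disj x); rewrite mem_cat ?xa ?xb orbT.
have qE : q = ta ++ b :: rev (belast cb tb) by rewrite /q lastI rev_rcons lastb.
have pathq : path (adj S) ca q.
  rewrite qE cat_path (sub_path sub_adj patha) lasta /=.
  apply/andP; split; first by apply/adjP; exists j.
  rewrite -lastb rev_path (eq_path (e' := adj S)) ?(sub_path sub_adj) //.
  by move=> x y; apply: adj_sym.
have [|P [pathP _ vP memP]] := seq_path _ Uq pathq.
  by rewrite qE; case: (ta).
exists C1, C2, P; split=> //; last first.
  apply: (memP (belast ca ta) a b (rev (belast cb tb))); last by [].
  by rewrite qE -cat_cons lastI lasta cat_rcons.
split.
  apply/pred0P => x /=; rewrite vC1 vC2 !inE; apply/negP => /andP[xa xb].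
  apply: (@disj x); rewrite mem_cat inE orbCA orbA.
    by rewrite xa.
  by rewrite xb.
exists ca, cb; split.
- by rewrite -lastq.
- by rewrite vC1 !inE eqxx.
- by rewrite vC2 !inE eqxx.
(* The tail of a lollipop meets its cycle only at [c]. *)
have meet c s t x : uniq (s ++ c :: t) -> x \in c :: s -> x \in c :: t -> x = c.
  rewrite !inE cat_uniq => /and3P[_ /hasPn nst _] /predU1P[-> // | xs] /predU1P[// | xt].
  by have := nst x; rewrite inE xt orbT /= xs => /(_ isT).
rewrite vP vC1 vC2; apply/setP => x.
rewrite in_setI in_setU in_set2 !in_set -cat_cons mem_cat mem_rev.
apply/andP/orP => [[/orP[xa|xb] /orP[ya|yb]]|[/eqP->|/eqP->]].
- by left; apply/eqP/(meet _ _ _ _ Ua).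
- by case: (@disj x); rewrite mem_cat ?xa ?orbT // inE orbCA orbA; apply/orP; left.
- by case: (@disj x); rewrite mem_cat ?xb ?orbT // inE orbCA orbA; apply/orP; left.
- by right; apply/eqP/(meet _ _ _ _ Ub).
- by rewrite !mem_head.
- by rewrite !mem_head !orbT.
Qed.
End Graph.

(** * The kernel of the incidence matrix *)

(** There is a rational kernel vector [y]; multiplying it by the product [d] of all its denominators
    makes it integral. *)
Lemma det0_int k (M : 'M[int]_k) :
  \det M = 0 -> exists2 z : 'cV[int]_k, z != 0 & M *m z = 0.
Proof.
move=> detM; pose MQ := map_mx intr M : 'M[rat]_k.
have /det0P[y y0 yM] : \det MQ^T == 0 by rewrite det_tr det_map_mx detM.
pose d := \prod_j denq (y 0 j).
pose z := \col_j (numq (y 0 j) * \prod_(l | l != j) denq (y 0 l)).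
have zE : map_mx intr z = d%:~R *: y^T.
  apply/matrixP => i l; rewrite !mxE [l]ord1.
  rewrite [d](bigD1 i) //= !intrM numqE.
  by rewrite [RHS]mulrC mulrA.
have d0 : d%:~R != 0 :> rat.
  by rewrite intr_eq0; apply/prodf_neq0 => i _; apply: denq_neq0.
exists z.
  apply: contraNneq y0 => z0; move: zE; rewrite z0 map_mx0 => /esym/eqP.
  rewrite scaler_eq0 (negPf d0) /= => /eqP yT0.
  by rewrite -[y]trmxK yT0 trmx0.
have MzQ : map_mx intr (M *m z) = 0 :> 'cV[rat]_k.
  by rewrite map_mxM zE -scalemxAr -[map_mx _ M]trmxK -trmx_mul yM trmx0 scaler0.
apply/matrixP => i l; apply/eqP; have /matrixP/(_ i l)/eqP := MzQ.
by rewrite !mxE intr_eq0.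
Qed.

Section Kernel.
Variables (n m : nat) (D : wograph n m).
Implicit Types (z : 'cV[int]_m) (C : {set 'I_m}).

Definition supp z : {set 'I_m} := [set j | z j 0 != 0].

Lemma supp_neq0 z : (supp z != set0) = (z != 0).
Proof.
apply/set0Pn/idP => [[j]|]; first by rewrite inE; apply: contraNneq => ->; rewrite mxE.
move=> z0; apply/existsP; apply: contraNT z0; rewrite negb_exists => /forallP z0.
apply/eqP/matrixP => j l; rewrite [l]ord1 mxE.
by apply/eqP; have := z0 j; rewrite inE negbK.
Qed.

Lemma incidence_eq0 x j : (incidence D x j == 0) = (x \notin endpoints D j).
Proof.
rewrite mxE !inE; case: (x == src D j) => //=.
by case: (x == tgt D j) => //=; rewrite eqz_nat eqn0Ngt wt_gt0.
Qed.

(** At a leaf the row equation would have a single nonzero term, the weights being positive. *)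
Lemma supp_no_leaf z : incidence D *m z = 0 -> no_leaf D (supp z).
Proof.
move=> Az x j zj xj; have [/existsP[i /and3P[]]|no_i] :=
    boolP [exists i, [&& i \in supp z, i != j & x \in endpoints D i]].
  by exists i.
have /eqP := congr1 (fun M : 'cV[int]_n => M x 0) Az; rewrite !mxE (bigD1 j) //= big1.
  rewrite addr0 mulf_eq0 incidence_eq0 xj /=.
  by move: zj; rewrite inE => /negPf ->.
move=> i ij; apply/eqP; rewrite mulf_eq0 incidence_eq0.
have := no_i; rewrite negb_exists => /forallP/(_ i); rewrite inE ij /=.
by rewrite negb_and negbK orbC.
Qed.

Lemma cycle_edge_inj C k (v : 'I_k -> 'I_n) (e : 'I_k -> 'I_m) :
  cycle_listing D C v e -> injective e.
Proof.
case=> k2 v_inj eE _ i l eil.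
have : [set v i; v (ordS i)] = [set v l; v (ordS l)] by rewrite -!eE eil.
move/setP => vE; have := vE (v i); have := vE (v l).
rewrite !inE !eqxx /= !(inj_eq v_inj) [l == i]eq_sym.
case: (i =P l) => //= _ /eqP sl /esym/eqP il.
(* Two distinct positions with the same edge succeed each other, so 2 would be 0 modulo [k], against
   [2 < k]. *)
have /(congr1 val)/eqP /= : i = ordS (ordS i) by rewrite -sl -il.
rewrite -[(_ %% _).+1]addn1 modnDml addn1 -addn2 => iE.
have : (i + 0 == i + 2 %[mod k])%N by rewrite addn0 -(eqP iE) modn_small.
by rewrite eqn_modDl mod0n modn_small.
Qed.

(** A kernel vector of the singular matrix of the cycle is extended by zero; the rows at vertices
    off the cycle vanish on its edges. *)
Lemma balanced_kernel C : balanced_cycle D C ->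
  exists z, [/\ z != 0, incidence D *m z = 0 & supp z \subset C].
Proof.
case=> k [v [e [listC detC]]]; have e_inj := cycle_edge_inj listC.
case: listC => _ v_inj eE CE; have [y y0 yM] := det0_int detC.
pose z : 'cV[int]_m := \sum_i y i 0 *: delta_mx (e i) 0.
have zE i : z (e i) 0 = y i 0.
  rewrite /z summxE (bigD1 i) //= big1 ?addr0 => [|l li]; rewrite !mxE.
    by rewrite !eqxx mulr1.
  by rewrite (inj_eq e_inj) eq_sym (negPf li) mulr0.
have Az x : (incidence D *m z) x 0 = \sum_i incidence D x (e i) * y i 0.
  rewrite mulmx_sumr summxE; apply: eq_bigr => i _.
  by rewrite -scalemxAr -colE !mxE mulrC.
exists z; split.
- apply: contraNneq y0 => z0; apply/eqP/matrixP => i l.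
  by rewrite [l]ord1 -zE z0 !mxE.
- apply/matrixP => x l; rewrite [l]ord1 Az mxE.
  have [/existsP[i /eqP xi]|no_i] := boolP [exists i, x == v i].
    transitivity ((mxsub v e (incidence D) *m y) i 0); last by rewrite yM mxE.
    by rewrite mxE; apply: eq_bigr => l' _; rewrite xi [mxsub _ _ _ _ _]mxE.
  rewrite big1 // => i _; apply/eqP; rewrite mulf_eq0 incidence_eq0 eE !inE.
  move: no_i; rewrite negb_exists => /forallP no_i.
  by rewrite negb_or !no_i.
- apply/subsetP => j; rewrite inE; apply: contraNT; rewrite CE => jC.
  rewrite /z summxE big1 // => i _; rewrite !mxE [j == e i](_ : _ = false) ?mulr0 //.
  by apply: contraNF jC => /eqP ->; apply: imset_f.
Qed.

Lemma unbalanced_kernel C z : unbalanced_cycle D C ->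
  incidence D *m z = 0 -> supp z \subset C -> z = 0.
Proof.
case=> -[k [v [e listC]]] unb Az zC; have e_inj := cycle_edge_inj listC.
pose M := mxsub v e (incidence D); pose y := \col_i z (e i) 0.
have detM : \det M != 0 by apply/eqP => detM; apply: unb; exists k, v, e.
case: listC => _ _ _ CE.
have z0 j : j \notin C -> z j 0 = 0.
  by move=> jC; apply/eqP; apply: contraNT jC => zj; apply: (subsetP zC); rewrite inE.
have My : M *m y = 0.
  apply/matrixP => i l; transitivity ((incidence D *m z) (v i) 0); last first.
    by rewrite Az !mxE.
  rewrite [LHS]mxE [RHS]mxE [RHS](bigID (mem C)) /= [X in _ = _ + X]big1 => [|j jC].
    rewrite addr0 CE (big_imset _ (in2W e_inj)) /=.
    by apply: eq_bigr => l' _; rewrite [M i l']mxE [y l' l]mxE.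
  by rewrite z0 // mulr0.
(* Over the integers the adjugate replaces the inverse of [M]. *)
have /eqP : \det M *: y = 0.
  by rewrite -mul_scalar_mx -mul_adj_mx -mulmxA My mulmx0.
rewrite scalemx_eq0 (negPf detM) /= => /eqP y0.
apply/matrixP => j l; rewrite [l]ord1 mxE; have [|/z0 //] := boolP (j \in C).
rewrite CE => /imsetP[i _ ->].
by have := congr1 (fun N : 'cV[int]_k => N i 0) y0; rewrite !mxE.
Qed.
End Kernel.

(** * Kernel vectors of minimal support *)

Section Elementary.
Variables (n m : nat) (D : wograph n m).
Implicit Types (y z : 'cV[int]_m) (B C P : {set 'I_m}) (f g j : 'I_m).

Definition elementary z :=
  [/\ z != 0, incidence D *m z = 0 &
    forall y, y != 0 -> incidence D *m y = 0 -> supp y \subset supp z ->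
      supp y = supp z].

(** Circuit elimination without denominators: the coordinate [g] cancels. *)
Definition eliminate g z y : 'cV[int]_m := y g 0 *: z - z g 0 *: y.

Lemma eliminateE g z y j : eliminate g z y j 0 = y g 0 * z j 0 - z g 0 * y j 0.
Proof. by rewrite !mxE. Qed.

Lemma eliminate_kernel g z y : incidence D *m z = 0 -> incidence D *m y = 0 ->
  incidence D *m eliminate g z y = 0.
Proof. by move=> Az Ay; rewrite mulmxBr -!scalemxAr Az Ay !scaler0 subr0. Qed.

Lemma eliminate_supp g z y : supp (eliminate g z y) \subset (supp z :|: supp y) :\ g.
Proof.
apply/subsetP => j; rewrite !inE eliminateE; apply: contraNT.
rewrite negb_and negb_or !negbK => /orP[/eqP ->|/andP[/eqP -> /eqP ->]].
  by rewrite mulrC subrr.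
by rewrite !mulr0 subrr.
Qed.

Lemma eliminate_notin g z y j : y j 0 = 0 ->
  (j \in supp (eliminate g z y)) = (g \in supp y) && (j \in supp z).
Proof. by move=> yj; rewrite !inE eliminateE yj mulr0 subr0 mulf_eq0 negb_or. Qed.

(** Induction on the support. A kernel vector [y] of smaller support either contains [f], or can be
    used to eliminate one of its coordinates from [z]; [f] survives this because [y] vanishes
    there. *)
Lemma ex_elementary z f : incidence D *m z = 0 -> f \in supp z ->
  exists y, [/\ elementary y, f \in supp y & supp y \subset supp z].
Proof.
have [k] := ubnP #|supp z|; elim: k z => // k IHk z lt_k Az fz.
have [elz|nelz] := classic (elementary z); first by exists z.
have [y [y0 Ay yz]] : exists y, [/\ y != 0, incidence D *m y = 0 & supp y \proper supp z].
  apply: NNPP => no_y; apply: nelz; split=> //.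
    by rewrite -supp_neq0; apply/set0Pn; exists f.
  move=> y y0 Ay yz; apply/eqP; apply: contraT => neq_yz; case: no_y.
  by exists y; rewrite properEneq neq_yz.
have [w [Aw fw wz]] :
    exists w, [/\ incidence D *m w = 0, f \in supp w & supp w \proper supp z].
  have [fy|fy] := boolP (f \in supp y); first by exists y.
  have /set0Pn[g gy] : supp y != set0 by rewrite supp_neq0.
  have gz := subsetP (proper_sub yz) g gy.
  have yf : y f 0 = 0 by apply/eqP; move: fy; rewrite inE negbK.
  exists (eliminate g z y); split; first exact: eliminate_kernel.
    by rewrite eliminate_notin // gy.
  apply: sub_proper_trans (eliminate_supp _ _ _) _.
  by rewrite (setUidPl (proper_sub yz)) properD1.
have [|x [elx fx xw]] := IHk w _ Aw fw.
  by rewrite -ltnS (leq_trans _ lt_k) // ltnS (proper_card wz).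
by exists x; split=> //; apply: subset_trans xw (proper_sub wz).
Qed.

(** Eliminating [g] leaves a kernel vector whose support is properly inside [supp z], hence zero by
    minimality. *)
Lemma elementary_prop z y g : elementary z -> incidence D *m y = 0 ->
  supp y \subset supp z -> g \in supp z -> y g 0 *: z = z g 0 *: y.
Proof.
case=> z0 Az minz Ay yz gz; apply/eqP; rewrite -subr_eq0 -/(eliminate g z y).
apply: contraT => w0; have := eliminate_supp g z y.
rewrite (setUidPl yz) => sw; have /setP/(_ g) : supp (eliminate g z y) = supp z.
  apply: minz => //; first exact: eliminate_kernel.
  by apply: subset_trans sw (subD1set _ _).
by rewrite gz => /(subsetP sw); rewrite !inE eqxx.
Qed.

Hypothesis two : at_most_two_unbalanced D.
Hypothesis cond_i : forall C1 C2 P B,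
  exactly_two_unbalanced D C1 C2 -> connects D P C1 C2 ->
  balanced_cycle D B -> ~ share_edge B P.
Hypothesis cond_ii : forall B1 B2,
  balanced_cycle D B1 -> balanced_cycle D B2 -> B1 <> B2 -> ~ share_path D B1 B2.

Lemma cycle_neq0 C : is_cycle D C -> C != set0.
Proof.
case=> k [v [e [k2 _ _ ->]]]; apply/set0Pn.
by exists (e (Ordinal (ltnW (ltnW k2)))); apply: imset_f.
Qed.

Lemma connects_neq P C1 C2 : is_cycle D C1 -> connects D P C1 C2 -> C1 <> C2.
Proof.
move=> cyc [disj _] eqC; have /set0Pn[j jC] := cycle_neq0 cyc.
move: disj; rewrite -eqC -setI_eq0 setIid.
move/eqP/setP/(_ (src D j)); rewrite inE => /negP; apply; apply/bigcupP.
by exists j; rewrite // !inE eqxx.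
Qed.

(** A single edge is already a path of length 1, so (ii) forbids even a common edge. *)
Lemma balanced_share_edge B1 B2 j : balanced_cycle D B1 -> balanced_cycle D B2 ->
  j \in B1 -> j \in B2 -> B1 = B2.
Proof.
move=> b1 b2 j1 j2; apply: NNPP => neq; apply: (cond_ii b1 b2 neq).
have adj_j : adj D [set j] (src D j) (tgt D j).
  by apply/adjP; exists j; rewrite ?set11.
have [//||P [pathP sP _ _]] := @seq_path n m D [set j] (src D j) [:: tgt D j] isT.
- by rewrite /= inE no_loop.
- by rewrite /= adj_j.
have sub B : j \in B -> P \subset B.
  by move=> jB; apply: subset_trans sP _; rewrite sub1set.
by exists P, (src D j), (tgt D j); split; rewrite ?sub.
Qed.

Lemma unbalanced_pair C1 C2 C : unbalanced_cycle D C1 -> unbalanced_cycle D C2 ->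
  C1 <> C2 -> unbalanced_cycle D C -> C = C1 \/ C = C2.
Proof. by move=> u1 u2 neq u; case: (two u1 u2 u) => // ->; [left|right]. Qed.

(** A balanced cycle inside [supp z] would carry a kernel vector and so equal [supp z]; hence all
    cycles inside are unbalanced, and [C1], [C2] are the only ones. An edge on neither is a bridge,
    so it lies on a path connecting them and by (i) on no balanced cycle. *)
Lemma elementary_unbalanced z : elementary z -> ~ balanced_cycle D (supp z) ->
  exists C1 C2, [/\ C1 <> C2, unbalanced_cycle D C1 /\ C1 \subset supp z,
    unbalanced_cycle D C2 /\ C2 \subset supp z &
    forall B j, balanced_cycle D B -> j \in B -> j \in supp z ->
      j \in C1 :|: C2].
Proof.
case=> z0 Az minz nbal.
have unbal C : is_cycle D C -> C \subset supp z -> unbalanced_cycle D C.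
  move=> cyc sC; split=> // bal; have [y [y0 Ay sy]] := balanced_kernel bal.
  apply: nbal; suff <- : C = supp z by [].
  apply/eqP; rewrite eqEsubset sC -(minz y) //.
  exact: subset_trans sy sC.
have nl := supp_no_leaf Az.
have [C1 [C2 [neq [cyc1 s1] [cyc2 s2]]]] : exists C1 C2, [/\ C1 <> C2,
    is_cycle D C1 /\ C1 \subset supp z & is_cycle D C2 /\ C2 \subset supp z].
  (* A bridge yields two disjoint cycles. Otherwise every edge is on a cycle, and one unbalanced
     cycle cannot cover [supp z] as it carries no nonzero kernel vector. *)
  have [[j [jz nj]]|covered] := classic (exists j, j \in supp z /\
      forall C, is_cycle D C -> C \subset supp z -> j \notin C).
    have [C1 [C2 [P [[cyc1 s1] c2 con _]]]] := bridge_connects nl jz nj.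
    by exists C1, C2; split=> //; apply: connects_neq con.
  have cover j : j \in supp z ->
      exists C, [/\ is_cycle D C, C \subset supp z & j \in C].
    move=> jz; apply: NNPP => nC; apply: covered; exists j; split=> // C cyc sC.
    by apply/negP => jC; apply: nC; exists C.
  have /set0Pn[j0 /cover[C1 [cyc1 s1 _]]] : supp z != set0 by rewrite supp_neq0.
  have /subsetPn[j1 /cover[C2 [cyc2 s2 j2]] j1'] : ~~ (supp z \subset C1).
    apply: contraNN z0 => sz.
    by rewrite (unbalanced_kernel (unbal _ cyc1 s1) Az sz).
  by exists C1, C2; split=> // eqC; rewrite eqC j2 in j1'.
have [u1 u2] := (unbal _ cyc1 s1, unbal _ cyc2 s2).
exists C1, C2; split=> // B j bB jB jz; apply: contraT => jC.
have [|C3 [C4 [P [[cyc3 s3] [cyc4 s4] con jP]]]] := bridge_connects nl jz.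
  move=> C cyc sC; apply: contraNN jC => jC; rewrite inE.
  by case: (unbalanced_pair u1 u2 neq (unbal _ cyc sC)) => <-; rewrite jC ?orbT.
have [u3 u4] := (unbal _ cyc3 s3, unbal _ cyc4 s4).
have neq34 := connects_neq cyc3 con.
have ex2 : exactly_two_unbalanced D C3 C4.
  split=> // C; split; first exact: unbalanced_pair.
  by case=> ->.
by case: (cond_i ex2 con bB); exists j.
Qed.

(** If the supports differ, a common edge [g] is eliminated and an elementary [w] avoiding [g] is
    found. In each case not settled by (ii) alone, [g] is such that [supp w] must contain it after
    all. *)
Lemma elementary_meet z y j : elementary z -> elementary y ->
  j \in supp z -> j \in supp y -> supp z = supp y.
Proof.
have elim_el g x1 x2 : elementary x1 -> elementary x2 -> g \in supp x1 ->
    g \in supp x2 -> supp x1 <> supp x2 ->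
  exists w, [/\ elementary w, g \notin supp w & supp w \subset supp x1 :|: supp x2].
  move=> el1 el2 g1 g2 neq; pose w := eliminate g x1 x2.
  case: (el1) (el2) => [x10 A1 m1] [x20 A2 m2].
  have : supp w != set0.
    apply/eqP => w0; apply: neq; apply: m2 => //.
    apply/subsetP => j1 j1x; apply: contraT => j2.
    have x2j : x2 j1 0 = 0 by apply/eqP; move: j2; rewrite inE negbK.
    by have := eliminate_notin g x1 x2j; rewrite -/w w0 g2 j1x inE.
  case/set0Pn => f /(ex_elementary (eliminate_kernel g A1 A2))[x [elx _ sx]].
  have sx' := subset_trans sx (eliminate_supp _ _ _).
  exists x; split=> //; last exact: subset_trans sx' (subD1set _ _).
  by apply/negP => /(subsetP sx'); rewrite !inE eqxx.
(* Here [g] lies in [C1 :|: C2]. An unbalanced [w] contains both cycles; a balanced [w] either lies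
   in [supp x2] and equals it, or shares an edge with [supp x1] and equals that. *)
have mixed g x1 x2 : elementary x1 -> elementary x2 ->
    balanced_cycle D (supp x1) -> ~ balanced_cycle D (supp x2) ->
    g \in supp x1 -> g \in supp x2 -> False.
  move=> el1 el2 b1 nb2 g1 g2.
  have [|w [elw gw sw]] := elim_el g x1 x2 el1 el2 g1 g2.
    by move=> eqx; rewrite eqx in b1.
  have [C1 [C2 [neq [u1 s1] [u2 s2] bal]]] := elementary_unbalanced el2 nb2.
  have gC := bal _ g b1 g1 g2.
  have [bw|nbw] := classic (balanced_cycle D (supp w)).
    have [|] := boolP (supp w \subset supp x2).
      by case: el2 (elw) => _ _ m2 [w0 Aw _] /(m2 _ w0 Aw) ww; rewrite ww g2 in gw.
    case/subsetPn => f fw fx2; have := subsetP sw f fw.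
    rewrite inE (negPf fx2) orbF => fx1.
    by rewrite (balanced_share_edge bw b1 fw fx1) g1 in gw.
  have [C3 [C4 [neq' [u3 s3] [u4 s4] _]]] := elementary_unbalanced elw nbw.
  case/negP: gw; apply: (subsetP (_ : C1 :|: C2 \subset supp w)) gC.
  rewrite subUset; apply/andP; split.
    by case: (unbalanced_pair u3 u4 neq' u1) => ->.
  by case: (unbalanced_pair u3 u4 neq' u2) => ->.
move=> elz ely jz jy.
have [bz|nbz] := classic (balanced_cycle D (supp z)).
  have [by_|nby] := classic (balanced_cycle D (supp y)).
    exact: balanced_share_edge bz by_ jz jy.
  by case: (mixed j z y).
have [by_|nby] := classic (balanced_cycle D (supp y)).
  by case: (mixed j y z).
apply: NNPP => neq.
have [C1 [C2 [neq1 [u1 s1] [u2 s2] balz]]] := elementary_unbalanced elz nbz.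
have [C3 [C4 [neq3 [u3 s3] [u4 s4] baly]]] := elementary_unbalanced ely nby.
have C34 : C3 :|: C4 \subset C1 :|: C2.
  rewrite subUset; apply/andP; split.
    by case: (unbalanced_pair u1 u2 neq1 u3) => ->; rewrite ?subsetUl ?subsetUr.
  by case: (unbalanced_pair u1 u2 neq1 u4) => ->; rewrite ?subsetUl ?subsetUr.
have C1y : C1 \subset supp y.
  by case: (unbalanced_pair u3 u4 neq3 u1) => ->.
(* Both supports contain both unbalanced cycles, so [g] may be chosen in [C1]. A balanced [w] then
   lies in [C1 :|: C2], inside [supp z], and an unbalanced one contains [C1]. *)
have /set0Pn[g gC] : C1 != set0 by case: u1 => /cycle_neq0.
have [w [elw gw sw]] :=
  elim_el g z y elz ely (subsetP s1 g gC) (subsetP C1y g gC) neq.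
have [bw|nbw] := classic (balanced_cycle D (supp w)).
  have wC : supp w \subset C1 :|: C2.
    apply/subsetP => f fw; have := subsetP sw f fw; rewrite inE => /orP[fz|fy].
      exact: balz bw fw fz.
    exact: (subsetP C34) (baly _ _ bw fw fy).
  case: elz elw => _ _ mz [w0 Aw _].
  have ww : supp w = supp z.
    by apply: mz => //; apply: subset_trans wC _; rewrite subUset s1 s2.
  by rewrite ww (subsetP s1 g gC) in gw.
have [C5 [C6 [neq5 [u5 s5] [u6 s6] _]]] := elementary_unbalanced elw nbw.
case/negP: gw; apply: (subsetP (_ : C1 \subset supp w)) gC.
by case: (unbalanced_pair u5 u6 neq5 u1) => ->.
Qed.

End Elementary.

(** * Irreducibility of binomials *)

(** This form excludes the zero vector, since 0 divides all its entries. *)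
Definition coprime_entries m (z : 'cV[int]_m) :=
  forall d : nat, (forall j, d %| absz (z j 0%R))%N -> d = 1%N.

(** Let [b / a] be the ratio of [y] to [z] in lowest terms. Then [a] divides every entry of [z], so
    it is a sign and its own inverse, which makes the ratio [a * b]. *)
Lemma coprime_entries_multiple m (z y : 'cV[int]_m) g : coprime_entries z ->
  z g 0 != 0 -> z g 0 *: y = y g 0 *: z -> exists k : int, y = k *: z.
Proof.
move=> z1 zg zy; pose q := gcdz (z g 0) (y g 0).
have q0 : q != 0 by rewrite gcdz_eq0 negb_and zg.
pose a := (z g 0%R %/ q)%Z; pose b := (y g 0%R %/ q)%Z.
have aE : z g 0 = a * q by rewrite divzK // dvdz_gcdl.
have bE : y g 0 = b * q by rewrite divzK // dvdz_gcdr.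
have ab j : a * y j 0 = b * z j 0.
  apply: (mulIf q0); rewrite mulrAC -aE [RHS]mulrAC -bE.
  by have /matrixP/(_ j 0) := zy; rewrite !mxE.
have cop : coprimez a b.
  apply/eqP/(mulIf q0); rewrite mul1r -[in LHS](_ : `|q|%N%:Z = q) //.
  by rewrite mulz_gcdl -aE -bE.
have a1 : `|a|%N = 1%N.
  apply: z1 => j; have : (a %| b * z j 0%R)%Z by rewrite -ab dvdz_mulr.
  by rewrite Gauss_dvdzr.
exists (a * b); apply/matrixP => j l; rewrite [l]ord1 mxE -mulrA -ab mulrA.
have -> : a * a = 1; last by rewrite mul1r.
by case: a a1 {ab cop aE} => [] [|[]].
Qed.

(** Induction on [N]: the product vanishes at 0, so one factor is divisible by the variable, which
    cancels. *)
Lemma mul_eq_CXn (R : idomainType) (p q : {poly R}) r N :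
  r != 0 -> p * q = r%:P * 'X^N -> exists s i, p = s%:P * 'X^i.
Proof.
have X0 : 'X != 0 :> {poly R} by rewrite polyX_eq0.
move=> r0; elim: N p q => [|N IHN] p q pq.
  have : p * q != 0 by rewrite pq mulr1 polyC_eq0.
  rewrite mulf_eq0 negb_or => /andP[p0 q0].
  have := congr1 (fun t : {poly R} => size t) pq.
  rewrite mulr1 size_polyC r0 size_mul // => sz.
  exists p`_0, 0%N; rewrite mulr1; apply: size1_polyC.
  by move: sz p0 q0; rewrite -!size_poly_gt0; lia.
have : root (p * q) 0 by rewrite pq exprSr /root hornerM hornerC hornerMX !mulr0.
rewrite rootM => /orP[] /factor_theorem[t]; rewrite subr0 => tE.
  have tq : t * q = r%:P * 'X^N.
    apply: (mulIf X0); rewrite mulrAC -tE pq exprSr; ring.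
  have [s [i sE]] := IHN _ _ tq; exists s, i.+1.
  by rewrite tE sE exprSr mulrA.
apply: (IHN p t); apply: (mulIf X0).
by rewrite -mulrA -tE pq exprSr mulrA.
Qed.

Lemma size_mul_ltn (R : idomainType) (p q : {poly R}) i j k :
  (i < size p)%N -> (j < size q)%N -> (size (p * q)%R <= k.+1)%N -> (i + j <= k)%N.
Proof.
move=> ip jq; have p0 : p != 0 by rewrite -size_poly_gt0 (leq_ltn_trans _ ip).
have q0 : q != 0 by rewrite -size_poly_gt0 (leq_ltn_trans _ jq).
rewrite (size_mul p0 q0); lia.
Qed.

Section WeightedDegree.
Variables (K : fieldType) (m : nat) (c : 'I_m -> nat).
Implicit Types (p q : {mpoly K[m]}) (a b u v : 'X_{1..m}).

Definition wdeg a := (\sum_j c j * a j)%N.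

(* The variable of the outer polynomial ring records the weighted degree. *)
Definition grade : {mpoly K[m]} -> {poly {mpoly K[m]}} :=
  mmap (polyC \o @mpolyC m K) (fun j => ('X_j)%:P * 'X^(c j)).

HB.instance Definition _ := GRing.RMorphism.on grade.

Lemma gradeX a : grade 'X_[a] = ('X_[a])%:P * 'X^(wdeg a).
Proof.
rewrite /grade mmapX /mmap1.
under eq_bigr => j _ do rewrite exprMn -exprM -rmorphXn /=.
rewrite big_split /= -rmorph_prod -mpolyXE_id; congr (_ * _).
by rewrite /wdeg expr_sum.
Qed.

(** Thus the coefficients of [grade p] are the homogeneous components of [p]. *)
Lemma grade_coef p k a : (grade p)`_k@_a = if wdeg a == k then p@_a else 0.
Proof.
have -> : grade p = \sum_(b <- msupp p) (p@_b *: 'X_[b])%:P * 'X^(wdeg b).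
  rewrite {1}[p]mpolyE raddf_sum; apply: eq_bigr => b _.
  rewrite -mul_mpolyC [LHS]rmorphM rmorphM -mulrA /= -gradeX.
  by rewrite [X in X * _]mmapC.
rewrite coef_sum raddf_sum /= (eq_bigr (fun b =>
  if wdeg a == k then (p@_b *: 'X_[b])@_a else 0)) => [|b _].
  case: ifP => _; last by rewrite big1.
  by rewrite [in RHS](mpolyE p) raddf_sum.
rewrite coefCM coefXn mulr_natr mcoeffMn !mcoeffZ mcoeffX.
have [->|_] := eqVneq b a; first by rewrite eq_sym; case: eqP.
by rewrite mulr0 mul0rn if_same.
Qed.


Lemma grade_msupp p a : a \in msupp p -> (grade p)`_(wdeg a) != 0.
Proof.
rewrite mcoeff_msupp; apply: contraNneq => ga.
by have := grade_coef p (wdeg a) a; rewrite eqxx ga mcoeff0 => <-.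
Qed.

(** The binomial is homogeneous, so its grading is a monomial in the outer variable. Its divisor
    [grade p] is one as well, that is, [p] is homogeneous. *)
Lemma wdeg_factor p q u v a b :
    binomial K u v != 0 -> p * q = binomial K u v -> wdeg u = wdeg v ->
  a \in msupp p -> b \in msupp p -> wdeg a = wdeg b.
Proof.
move=> uv0 pq uv.
have : grade p * grade q = (binomial K u v)%:P * 'X^(wdeg u).
  by rewrite -rmorphM pq rmorphB /= !gradeX -uv rmorphB mulrBl.
case/(mul_eq_CXn uv0) => s [i pE].
have deg_i d : d \in msupp p -> wdeg d = i.
  move/grade_msupp; rewrite pE coefCM coefXn.
  by case: (wdeg d =P i) => //; rewrite mulr0 eqxx.
by move=> /deg_i -> /deg_i ->.
Qed.

Lemma wdeg_factor_le p q u v a b :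
    binomial K u v != 0 -> p * q = binomial K u v -> (wdeg v <= wdeg u)%N ->
  a \in msupp p -> b \in msupp q -> (wdeg a + wdeg b <= wdeg u)%N.
Proof.
move=> uv0 pq uv ap bq.
have lt_size d r : d \in msupp r -> (wdeg d < size (grade r))%N.
  move/grade_msupp; rewrite ltnNge; apply: contraNN => le_d.
  by rewrite nth_default.
have : (size (grade (binomial K u v)) <= (wdeg u).+1)%N.
  rewrite rmorphB /= !gradeX (leq_trans (size_polyD _ _)) // size_polyN geq_max.
  by apply/andP; split; apply: leq_trans (size_polyMleq _ _) _;
    rewrite size_polyXn addnS /= size_polyC; case: (_ != 0);
    rewrite // ?add0n ?add1n //=; apply: leqW.
have [lta ltb] := (lt_size _ _ ap, lt_size _ _ bq).
have <- : grade p * grade q = grade (binomial K u v) by rewrite -rmorphM pq.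
by move=> sz; have := size_mul_ltn lta ltb sz.
Qed.

End WeightedDegree.

Section Binomials.
Variables (K : fieldType) (m : nat).
Implicit Types (p q : {mpoly K[m]}) (a b u v : 'X_{1..m}) (j g : 'I_m).

Definition expo_diff u v : 'cV[int]_m := \col_j ((u j)%:Z - (v j)%:Z).

Lemma binomial_eq0 u v : (binomial K u v == 0) = (u == v).
Proof.
rewrite subr_eq0; apply/eqP/eqP => [|-> //] /(congr1 (fun p => p@_u)).
rewrite !mcoeffX eqxx; case: (v =P u) => // _ /eqP.
by rewrite oner_eq0.
Qed.

Lemma binomial_msupp u v : u != v -> msupp (binomial K u v) =i [:: u; v].
Proof.
move=> uv a; rewrite mcoeff_msupp mcoeffB !mcoeffX !inE ![a == _]eq_sym.
case: (u =P a) uv => [-> |_]; first by rewrite eq_sym => /negPf ->; rewrite subr0 oner_neq0.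
by case: (v =P a) => _ _; rewrite sub0r oppr_eq0 ?oner_neq0 ?eqxx.
Qed.

Lemma expo_diff_eq0 u v : (expo_diff u v == 0) = (u == v).
Proof.
apply/eqP/eqP => [/matrixP uv|->]; last by apply/matrixP => j l; rewrite !mxE subrr.
apply/mnmP => j; have := uv j 0; rewrite !mxE; lia.
Qed.

Definition disjoint_expo u v := forall j, u j = 0%N \/ v j = 0%N.

Lemma unit_mpoly p : p \is a GRing.unit -> exists2 c, c != 0 & p = c%:MP.
Proof.
rewrite unfold_in => /andP[/eqP pE pu]; exists p@_0%MM => //.
by rewrite -unitfE.
Qed.

Lemma wdeg_pair g j (al be : nat) a :
  wdeg (fun l => (l == g) * al + (l == j) * be)%N a = (al * a g + be * a j)%N.
Proof.
rewrite /wdeg; under eq_bigr => l _ do rewrite mulnDl.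
rewrite big_split /= (bigD1 g) //= eqxx mul1n big1 => [|l /negPf ->] //.
by rewrite addn0 (bigD1 j) //= eqxx mul1n big1 ?addn0 // => l /negPf ->.
Qed.

(* Every nonnegative weight orthogonal to [u - v] makes the binomial, hence its
   factors, homogeneous; weights supported on two coordinates [g, j] or [h, j]
   suffice to confine the exponents of a factor to a line. *)
Lemma factor_msupp_line p q u v g h a b :
    u != v -> disjoint_expo u v -> coprime_entries (expo_diff u v) ->
    (0 < u g)%N -> (0 < v h)%N -> p * q = binomial K u v ->
    a \in msupp p -> b \in msupp p ->
  exists k : int, expo_diff a b = k *: expo_diff u v.
Proof.
move=> uv disj cop ug vh pq ap bp.
have vg : v g = 0%N by case: (disj g) ug => ->.
have uh : u h = 0%N by case: (disj h) vh => ->.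
have uv0 : binomial K u v != 0 by rewrite binomial_eq0.
have pair l j al be : (al * u l + be * u j = al * v l + be * v j)%N ->
    (al * a l + be * a j = al * b l + be * b j)%N.
  by rewrite -!wdeg_pair => /(wdeg_factor uv0 pq); apply.
(* The weight [v j] on [g] and [u g] on [j] is orthogonal to [u - v]; the next one uses [h] in the
   same way. *)
have vj j : u j = 0%N -> (v j * a g + u g * a j = v j * b g + u g * b j)%N.
  by move=> uj; apply: pair; rewrite uj vg mulnC; lia.
have uj j : v j = 0%N -> (u j * a h + v h * a j = u j * b h + v h * b j)%N.
  by move=> vj0; apply: pair; rewrite vj0 uh mulnC; lia.
apply: (coprime_entries_multiple (g := g) cop); first by rewrite mxE; lia.
apply/matrixP => j l; rewrite [l]ord1 !mxE vg subr0.
have vhg := vj h uh; case: (disj j) => [uj0 | vj0].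
  by have := vj j uj0; rewrite uj0; lia.
have := uj j vj0; rewrite vj0 subr0 => ujh.
have {}ujh : (u j)%:Z * (a h)%:Z + (v h)%:Z * (a j)%:Z
    - ((u j)%:Z * (b h)%:Z + (v h)%:Z * (b j)%:Z) = 0 by lia.
have {}vhg : (v h)%:Z * (a g)%:Z + (u g)%:Z * (a h)%:Z
    - ((v h)%:Z * (b g)%:Z + (u g)%:Z * (b h)%:Z) = 0 by lia.
(* The coordinates [g] and [j] are both on the side of [u], so they are compared through [h]: the
   equation times [v h] is [u g] times [ujh] minus [u j] times [vhg]. *)
apply: (@mulfI _ (v h)%:Z); first by lia.
apply/eqP; rewrite -subr_eq0; apply/eqP.
rewrite -[RHS](subrr 0) -[X in _ = X - _](mulr0 (u g)%:Z) -{1}ujh.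
by rewrite -[X in _ = _ - X](mulr0 (u j)%:Z) -vhg; ring.
Qed.

(** Two exponents of [p] differ by a multiple of [u - v], whose entry at [g] is [u g]; the degree
    bound leaves one monomial. It divides both terms of the binomial, which are coprime, so it is
    constant. *)
Lemma factor_unit p q u v g h :
    u != v -> disjoint_expo u v -> coprime_entries (expo_diff u v) ->
    (0 < u g)%N -> (0 < v h)%N -> p * q = binomial K u v ->
    (forall a, a \in msupp p -> (a g < u g)%N) -> p \is a GRing.unit.
Proof.
move=> uv disj cop ug vh pq deg_p.
have vg : v g = 0%N by case: (disj g) ug => ->.
have uv0 : binomial K u v != 0 by rewrite binomial_eq0.
have p0 : p != 0 by apply: contraNneq uv0 => p0; rewrite -pq p0 mul0r.
pose a := mlead p; have ap : a \in msupp p by apply: mlead_supp.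
have pE : p = p@_a *: 'X_[a].
  rewrite [LHS]mpolyE (bigD1_seq a) ?msupp_uniq //= big1_seq ?addr0 // => b.
  case/andP=> ba bp; have [k kE] := factor_msupp_line uv disj cop ug vh pq bp ap.
  have /matrixP/(_ g 0) := kE; rewrite !mxE vg subr0 => bk.
  have k0 : k = 0.
    have := deg_p _ ap; have := deg_p _ bp; move: bk ug.
    move: (a g) (b g) (u g) => x y z; clear; nia.
  by move/eqP: kE; rewrite k0 scale0r expo_diff_eq0 (negPf ba).
have le_a w : w \in msupp (binomial K u v) -> (a <= w)%MM.
  rewrite -pq => /msuppM_le /allpairsP[[a1 a2] /= [a1p _ ->]].
  suff -> : a = a1 by apply: lem_addr.
  apply/eqP; apply: contraTT a1p => aa1.
  by rewrite -mcoeff_eq0 pE mcoeffZ mcoeffX (negPf aa1) mulr0.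
have a0 : a = 0%MM.
  apply/mnmP => j; rewrite mnm0E.
  have /mnm_lepP/(_ j) : (a <= u)%MM by rewrite le_a ?binomial_msupp // !inE eqxx.
  have /mnm_lepP/(_ j) : (a <= v)%MM by rewrite le_a ?binomial_msupp // !inE eqxx orbT.
  by case: (disj j) => ->; lia.
have pa0 : p@_a != 0 by rewrite -mcoeff_msupp.
by rewrite pE [in 'X_[_]]a0 mpolyX0 alg_mpolyC; apply: rmorph_unit; rewrite unitfE.
Qed.

Lemma irreducible_binomial u v :
    u != 0%MM -> v != 0%MM -> disjoint_expo u v ->
    coprime_entries (expo_diff u v) ->
  irreducible_mpoly (binomial K u v).
Proof.
have ex_pos w : w != 0%MM -> exists g, (0 < w g)%N.
  move=> w0; apply/existsP; apply: contraNT w0 => /existsPn w0.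
  by apply/eqP/mnmP => j; rewrite mnm0E; have := w0 j; rewrite -eqn0Ngt => /eqP.
move=> u0 v0 disj cop; have [[g ug] [h vh]] := (ex_pos u u0, ex_pos v v0).
have uv : u != v.
  apply/eqP => uv; case: (disj g) ug => [-> //|]; rewrite -uv => -> //.
have uv0 : binomial K u v != 0 by rewrite binomial_eq0.
split; first exact/eqP.
- apply/negP => /unit_mpoly[c c0 uvc].
  have := binomial_msupp uv u; rewrite uvc msuppC (negPf c0) !inE eqxx /=.
  by rewrite (negPf u0).
move=> p q /esym pq.
(* Along the line the coordinate [g] jumps by multiples of [u g], and the degrees
   of [p] and [q] in the variable [g] add up to [u g]: one of them is less than
   [u g], and that factor is a single monomial. *)
have [/allP deg_p|/allPn[a ap]] :=
    boolP (all (fun a : 'X_{1..m} => (a g < u g)%N) (msupp p)).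
  by left; apply: factor_unit uv disj cop ug vh pq deg_p.
rewrite -leqNgt => le_ug; right.
have qp : q * p = binomial K u v by rewrite mulrC.
apply: (factor_unit uv disj cop ug vh qp) => b bq.
(* With both indices equal to [g] and second weight 0, the pair weight is the degree in the variable
   [g]. *)
have := @wdeg_factor_le K m (fun l => (l == g) * 1 + (l == g) * 0)%N p q u v a b uv0 pq.
rewrite !wdeg_pair; case: (disj g) => E; rewrite E in ug * => //.
by rewrite !mul0n !mul1n !addn0 => /(_ isT ap bq); lia.
Qed.

End Binomials.

(** * Primitive binomials and circuits *)

Section ToricBinomials.
Variables (K : fieldType) (n m : nat) (D : wograph n m).
Implicit Types (a b u v : 'X_{1..m}) (y z : 'cV[int]_m) (p q : {mpoly K[m]}).

Definition edge_expo j : 'X_{1..n} :=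
  (U_(src D j) + U_(tgt D j) *+ wt D (tgt D j))%MM.

Definition image_expo u : 'X_{1..n} := (\sum_j edge_expo j *+ u j)%MM.

Lemma comp_monomial u :
  'X_[u] \mPo [tuple edge_monomial K D j | j < m] = 'X_[image_expo u].
Proof.
rewrite comp_mpolyX /image_expo (big_morph _ (@mpolyXD _ _) (@mpolyX0 _ _)).
by apply: eq_bigr => j _; rewrite tnth_mktuple /edge_monomial !mpolyXn -mpolyXD mpolyXn.
Qed.

Lemma toric_ideal_binomial u v :
  toric_ideal D (binomial K u v) <-> image_expo u = image_expo v.
Proof.
rewrite /toric_ideal comp_mpolyB !comp_monomial -/(binomial K _ _).
split=> [/eqP|->]; first by rewrite binomial_eq0 => /eqP.
by rewrite /binomial subrr.
Qed.

Lemma edge_expoE j x : (edge_expo j x)%:Z = incidence D x j.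
Proof.
rewrite mnmDE mulmnE !mnm1E mxE ![x == _]eq_sym.
have := no_loop D j; case: (src D j =P x) => [->|_] ne.
  by rewrite eq_sym (negPf ne).
by case: (tgt D j =P x) => [->|_]; rewrite ?mul1n.
Qed.

Lemma incidence_expo_diff u v x :
  (incidence D *m expo_diff u v) x 0 = (image_expo u x)%:Z - (image_expo v x)%:Z.
Proof.
rewrite mxE !mnm_sumE !(big_morph Posz PoszD (erefl _)) -sumrB.
by apply: eq_bigr => j _; rewrite -edge_expoE mxE !mulmnE !PoszM mulrBr.
Qed.

Lemma toric_binomialP u v :
  toric_binomial K D u v <-> u != v /\ incidence D *m expo_diff u v = 0.
Proof.
rewrite /toric_binomial toric_ideal_binomial; split=> -[uv].
  move=> im; split; first by rewrite -(binomial_eq0 K); apply/eqP.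
  by apply/matrixP => x l; rewrite [l]ord1 incidence_expo_diff im subrr mxE.
move=> Auv; split; first by apply/eqP; rewrite binomial_eq0.
apply/mnmP => x; have := incidence_expo_diff u v x; rewrite Auv mxE; lia.
Qed.

Lemma image_expo_eq0 u : image_expo u = 0%MM -> u = 0%MM.
Proof.
move=> im; apply/mnmP => j; have /mnmP/(_ (src D j)) := im.
rewrite mnm_sumE (bigD1 j) //= mulmnE !mnm0E mnmDE mnm1E eqxx.
lia.
Qed.

(** Each edge monomial contains its source variable, so only the monomial 1 maps to 1. *)
Lemma toric_binomial_neq0 u v : toric_binomial K D u v -> u != 0%MM /\ v != 0%MM.
Proof.
case=> uv0 /toric_ideal_binomial im.
have im0 : image_expo 0%MM = 0%MM.
  by rewrite /image_expo big1 // => j _; rewrite mnm0E mulm0n.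
have [uE|//] := eqVneq u 0%MM.
  case: uv0; rewrite uE (@image_expo_eq0 v) ?/binomial ?subrr // -im uE //.
have [vE|//] := eqVneq v 0%MM.
case: uv0; rewrite vE (@image_expo_eq0 u) ?/binomial ?subrr // im vE //.
Qed.

Lemma supp_vars_binomial u v : u != v ->
  supp_vars (binomial K u v) = [set j | (u j != 0%N) || (v j != 0%N)].
Proof.
move=> uv; apply/setP => j; rewrite !inE; apply/hasP/orP => [[w]|].
  by rewrite binomial_msupp // !inE => /orP[] /eqP ->; [left|right].
by case=> h; [exists u | exists v] => //; rewrite binomial_msupp // !inE eqxx ?orbT.
Qed.

Lemma supp_expo_diff u v : disjoint_expo u v ->
  supp (expo_diff u v) = [set j | (u j != 0%N) || (v j != 0%N)].
Proof. by move=> disj; apply/setP => j; rewrite !inE mxE; case: (disj j); lia. Qed.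

Lemma eq_up_to_sign_binomial u v u' v' : u != v ->
  eq_up_to_sign (binomial K u' v') (binomial K u v) ->
  (u' = u /\ v' = v) \/ (u' = v /\ v' = u).
Proof.
move=> uv eqb.
have uv' : u' != v'.
  move: uv; rewrite -!(binomial_eq0 K).
  by case: eqb => ->; rewrite ?oppr_eq0.
have memE : msupp (binomial K u' v') =i [:: u; v].
  move=> w; rewrite -(binomial_msupp K uv); case: eqb => -> //.
  by rewrite !mcoeff_msupp mcoeffN oppr_eq0.
have := memE u'; have := memE v'; rewrite !binomial_msupp // !inE !eqxx orbT /=.
move=> /esym/orP[]/eqP vE /esym/orP[]/eqP uE; subst;
  rewrite ?eqxx // in uv' *; by [left|right].
Qed.

(** The opposite sign would make [u] and [v] divide each other. *)
Lemma primitive_min u v u' v' : primitive K D u v -> toric_binomial K D u' v' ->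
  (u' <= u)%MM -> (v' <= v)%MM -> u' = u /\ v' = v.
Proof.
case=> /toric_binomialP[uv _] min tor le_u le_v.
case: (eq_up_to_sign_binomial uv (min _ _ tor le_u le_v)) => // -[uE vE].
move: le_u le_v; rewrite uE vE => /mnm_lepP le1 /mnm_lepP le2.
by case/eqP: uv; apply/mnmP => j; apply/eqP; rewrite eqn_leq le1 le2.
Qed.

Lemma primitive_disjoint u v : primitive K D u v -> disjoint_expo u v.
Proof.
move=> prim; case: (prim) => /toric_binomialP[uv Auv] _ j.
(* Subtraction of exponents is truncated: the new pair is [u], [v] with the common factor
   removed. *)
have diffE : expo_diff (u - v)%MM (v - u)%MM = expo_diff u v.
  apply/matrixP => i l; rewrite !mxE !mnmBE; lia.
have tor : toric_binomial K D (u - v)%MM (v - u)%MM.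
  by apply/toric_binomialP; rewrite -expo_diff_eq0 diffE expo_diff_eq0.
have le (w w' : 'X_{1..m}) : (w - w' <= w)%MM.
  by apply/mnm_lepP => i; rewrite mnmBE leq_subr.
have [/mnmP/(_ j) + _] := primitive_min prim tor (le u v) (le v u).
rewrite mnmBE; lia.
Qed.

Definition pos_part y : 'X_{1..m} :=
  [multinom if (0 <= y j 0)%R then absz (y j 0%R) else 0%N | j < m].

Lemma expo_diff_pos_part y : expo_diff (pos_part y) (pos_part (- y)) = y.
Proof.
apply/matrixP => j l; rewrite [l]ord1 !mxE !mnmE !mxE.
by case: ifP; case: ifP; move: (y j 0) => t; lia.
Qed.

(** Primitivity in the kernel is minimality for the conformal order: the positive and negative parts
    of such a [y] divide [u] and [v]. *)
Lemma primitive_conformal u v y : primitive K D u v -> y != 0 ->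
    incidence D *m y = 0 ->
    (forall j, 0 <= y j 0 <= (u j)%:Z - (v j)%:Z \/
               (u j)%:Z - (v j)%:Z <= y j 0 <= 0) ->
  y = expo_diff u v.
Proof.
move=> prim y0 Ay conf.
have tor : toric_binomial K D (pos_part y) (pos_part (- y)).
  by apply/toric_binomialP; rewrite -expo_diff_eq0 expo_diff_pos_part.
have [||<- <-] := primitive_min prim tor; last by rewrite expo_diff_pos_part.
  apply/mnm_lepP => j; rewrite mnmE; have := conf j.
  by move: (y j 0) => t; case: ifP; lia.
apply/mnm_lepP => j; rewrite mnmE !mxE; have := conf j.
by move: (y j 0) => t; case: ifP; lia.
Qed.

Lemma primitive_coprime u v : primitive K D u v -> coprime_entries (expo_diff u v).
Proof.
move=> prim d dvd; case: (prim) => /toric_binomialP[uv Auv] _.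
pose y : 'cV[int]_m := \col_j (expo_diff u v j 0%R %/ d)%Z.
have yE : expo_diff u v = d%:Z *: y.
  apply/matrixP => j l; rewrite [l]ord1 [RHS]mxE [y j 0]mxE mulrC divzK //.
  exact: dvd.
have z0 : expo_diff u v != 0 by rewrite expo_diff_eq0.
have d0 : d%:Z != 0 by apply: contraNneq z0 => d0; rewrite yE d0 scale0r.
have y0 : y != 0 by apply: contraNneq z0 => y0; rewrite yE y0 scaler0.
have Ay : incidence D *m y = 0.
  by apply/eqP; have /eqP := Auv; rewrite yE -scalemxAr scalemx_eq0 (negPf d0).
have : y = expo_diff u v.
  apply: (primitive_conformal prim) => // j.
  have /matrixP/(_ j 0) := yE; rewrite [LHS]mxE [RHS]mxE => ->.
  by move: (y j 0) => t; clear -d0; nia.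
move=> yz; move: y0; rewrite -supp_neq0 => /set0Pn[j]; rewrite inE => yj.
have /matrixP/(_ j 0) := yE; rewrite -yz [RHS]mxE -[LHS]mul1r => /(mulIf yj).
lia.
Qed.

Hypothesis meet : forall z y j, elementary D z -> elementary D y ->
  j \in supp z -> j \in supp y -> supp z = supp y.

(** The restriction of [u - v] to the support of an elementary vector inside it is again in the
    kernel and conformal to [u - v], so by primitivity it is all of [u - v]. *)
Lemma primitive_elementary u v : primitive K D u v -> elementary D (expo_diff u v).
Proof.
move=> prim; case: (prim) => /toric_binomialP[uv Az] _; set z := expo_diff u v in Az *.
have z0 : z != 0 by rewrite expo_diff_eq0.
have /set0Pn[f fz] : supp z != set0 by rewrite supp_neq0.
have [x [elx fx sxz]] := ex_elementary Az fz; case: (elx) => [x0 Ax minx].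
(* By [meet] the restriction [y] of [z] to [supp x] is proportional to [x]. *)
pose y : 'cV[int]_m := \col_j if j \in supp x then z j 0 else 0.
have xy : x f 0 *: y = z f 0 *: x.
  apply/matrixP => j l; rewrite [l]ord1 [LHS]mxE [RHS]mxE [y j 0]mxE.
  case: ifP => jx; last first.
    by move/negbT: jx; rewrite inE negbK => /eqP ->; rewrite !mulr0.
  (* If proportionality fails at [j], an elementary vector through [j] inside [supp w] has support
     [supp x] by [meet], hence contains the eliminated [f]. *)
  apply/eqP; apply: contraT => ne; pose w := eliminate f z x.
  have jw : j \in supp w by rewrite inE eliminateE subr_eq0.
  have [t [elt jt st]] := ex_elementary (eliminate_kernel f Az Ax) jw.
  have ft : f \in supp t by rewrite (meet elt elx jt jx).
  have := subsetP (eliminate_supp f z x) f (subsetP st f ft).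
  by rewrite !inE eqxx.
have xf0 : x f 0 != 0 by move: fx; rewrite inE.
have Ay : incidence D *m y = 0.
  apply/eqP; have := congr1 (mulmx (incidence D)) xy.
  rewrite -!scalemxAr Ax scaler0 => /eqP.
  by rewrite scalemx_eq0 (negPf xf0).
have y0 : y != 0.
  apply: contraTneq fz => y0; have /matrixP/(_ f 0) := y0.
  by rewrite mxE fx inE negbK => ->; rewrite mxE.
have yz : y = z.
  apply: (primitive_conformal prim) => // j; rewrite mxE; case: ifP => _.
    by rewrite mxE; lia.
  by lia.
have szx : supp z = supp x.
  apply/eqP; rewrite eqEsubset sxz andbT -yz; apply/subsetP => j.
  by rewrite inE mxE; case: ifP; rewrite ?eqxx.
by split=> // t; rewrite szx; apply: minx.
Qed.

Lemma elementary_primitive u v : disjoint_expo u v -> elementary D (expo_diff u v) ->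
  coprime_entries (expo_diff u v) -> primitive K D u v.
Proof.
move=> disj elz cop; case: (elz) => [z0 Az _].
split; first by apply/toric_binomialP; rewrite -expo_diff_eq0.
move=> u' v' /toric_binomialP[uv' Ay] /mnm_lepP le_u /mnm_lepP le_v.
pose z := expo_diff u v; pose y := expo_diff u' v'.
have sy : supp y \subset supp z.
  apply/subsetP => j; rewrite !inE !mxE; have := le_u j; have := le_v j.
  by case: (disj j); lia.
have y0 : y != 0 by rewrite expo_diff_eq0.
have /set0Pn[g gz] : supp z != set0 by rewrite supp_neq0.
have zg : z g 0 != 0 by move: gz; rewrite inE.
have [k yE] := coprime_entries_multiple cop zg (esym (elementary_prop elz Ay sy gz)).
have k1 : k = 1.
  have k0 : k != 0 by apply: contraNneq y0 => k0; rewrite /y yE k0 scale0r.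
  have /matrixP/(_ g 0) := yE; move: zg; rewrite !mxE.
  have := le_u g; have := le_v g; move: (disj g).
  move: (u g) (v g) (u' g) (v' g) => a b a' b'; clear -k0; nia.
have yz j : (u' j)%:Z - (v' j)%:Z = (u j)%:Z - (v j)%:Z.
  by have /matrixP/(_ j 0) := yE; rewrite k1 scale1r !mxE.
suff [-> ->] : u' = u /\ v' = v by left.
by split; apply/mnmP => j; have := le_u j; have := le_v j; have := yz j;
  case: (disj j); lia.
Qed.

Lemma graver_circuit p : graver D p -> circuit D p.
Proof.
case=> u [v [pE prim]]; exists u, v.
have [disj cop] := (primitive_disjoint prim, primitive_coprime prim).
have elz := primitive_elementary prim.
case: (prim) => tor _; have [u0 v0] := toric_binomial_neq0 tor.
split=> //; first by rewrite pE; apply: irreducible_binomial.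
move=> u' v' /toric_binomialP[uv' Ay]; case/toric_binomialP: tor => uv _.
rewrite pE !supp_vars_binomial // -(supp_expo_diff disj) => sub.
(* Only an inclusion: [u'] and [v'] may have a common factor that cancels in the difference. *)
have sub' : supp (expo_diff u' v') \subset [set j | (u' j != 0%N) || (v' j != 0%N)].
  by apply/subsetP => j; rewrite !inE mxE; lia.
case: elz => _ _ minz; apply/eqP; rewrite eqEsubset sub -(minz (expo_diff u' v')) //.
  by rewrite expo_diff_eq0.
exact: subset_trans sub' sub.
Qed.

Lemma irreducible_binomial_disjoint u v :
  irreducible_mpoly (binomial K u v) -> disjoint_expo u v.
Proof.
case=> /eqP; rewrite binomial_eq0 => uv _ irr j.
(* With truncated subtraction this is the componentwise minimum, the exponent of the greatest common
   divisor. *)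
pose w := (u - (u - v))%MM.
have uE : u = (w + (u - v))%MM by apply/mnmP => i; rewrite !mnmDE !mnmBE; lia.
have vE : v = (w + (v - u))%MM by apply/mnmP => i; rewrite !mnmDE !mnmBE; lia.
have : binomial K u v = 'X_[w] * binomial K (u - v)%MM (v - u)%MM.
  by rewrite /binomial mulrBr -!mpolyXD -uE -vE.
case/irr => /unit_mpoly[c c0 cE].
  have : w \in msupp ('X_[w] : {mpoly K[m]}) by rewrite msuppX inE.
  rewrite cE msuppC (negPf c0) inE => /eqP/mnmP/(_ j).
  by rewrite mnm0E !mnmBE; lia.
have uv' : (u - v)%MM != (v - u)%MM.
  by apply: contraNneq uv => uv'; rewrite uE [X in _ == X]vE uv'.
have mem0 i : i \in [:: (u - v)%MM; (v - u)%MM] -> i = 0%MM.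
  by rewrite -(binomial_msupp K uv') cE msuppC (negPf c0) inE => /eqP.
by case/eqP: uv'; rewrite [LHS]mem0 ?[RHS]mem0 // !inE eqxx ?orbT.
Qed.

Lemma irreducible_binomial_coprime u v :
  u != 0%MM -> irreducible_mpoly (binomial K u v) -> coprime_entries (expo_diff u v).
Proof.
move=> u0 irrb d dvd; have disj := irreducible_binomial_disjoint irrb.
case: irrb => /eqP; rewrite binomial_eq0 => uv _ irr.
have /existsP[g ug] : [exists g, u g != 0%N].
  apply: contraNT u0 => /existsPn h; apply/eqP/mnmP => j.
  by have := h j; rewrite negbK mnm0E => /eqP.
have d_uv j : (d %| u j)%N /\ (d %| v j)%N.
  have := dvd j; rewrite mxE; case: (disj j) => ->.
    by rewrite sub0r abszN dvdn0.
  by rewrite subr0 dvdn0.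
pose u' := [multinom (u j %/ d)%N | j < m].
pose v' := [multinom (v j %/ d)%N | j < m].
have uE : u = (u' *+ d)%MM.
  by apply/mnmP => j; rewrite mulmnE mnmE divnK //; case: (d_uv j).
have vE : v = (v' *+ d)%MM.
  by apply/mnmP => j; rewrite mulmnE mnmE divnK //; case: (d_uv j).
have uv' : u' != v' by apply: contraNneq uv => uv'; rewrite uE vE uv'.
have ug' : u' g != 0%N by apply: contraNneq ug => u'g; rewrite uE mulmnE u'g.
have := @subrXX {mpoly K[m]} 'X_[u'] 'X_[v'] d.
rewrite !mpolyXn -uE -vE -/(binomial K _ _) => bE.
case: (irr _ _ bE) => /unit_mpoly[c c0 cE].
  have mem0 i : i \in [:: u'; v'] -> i = 0%MM.
    by rewrite -(binomial_msupp K uv') /binomial cE msuppC (negPf c0) inE => /eqP.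
  by case/eqP: uv'; rewrite [LHS]mem0 ?[RHS]mem0 // !inE eqxx ?orbT.
have : u \in msupp (binomial K u v) by rewrite binomial_msupp // inE eqxx.
rewrite bE cE mulrC mcoeff_msupp mcoeffCM mulf_eq0 negb_or => /andP[_].
rewrite -mcoeff_msupp -/(binomial K u' v') binomial_msupp // !inE.
(* If the cofactor is constant, [u] is [u'] or [v']. The first gives [d = 1]; the second makes [v]
   nonzero at [g], against disjointness. *)
case/orP => /eqP/mnmP/(_ g) ugE.
  move: ugE ug'; rewrite uE mulmnE.
  by case: (u' g) => // t; case: d {dvd d_uv u' v' uE vE uv' bE cE}; nia.
have vg : v g = 0%N by case: (disj g) ug => ->.
move: vg ug; rewrite vE mulmnE -ugE => /eqP; rewrite muln_eq0.
by case/orP => /eqP d0; rewrite ?d0 // uE mulmnE d0 muln0.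
Qed.

Lemma circuit_graver p : circuit D p -> graver D p.
Proof.
case=> u [v [pE tor irr min]]; exists u, v; split=> //.
have [u0 v0] := toric_binomial_neq0 tor; case/toric_binomialP: (tor) => uv Az.
rewrite pE in irr min; have disj := irreducible_binomial_disjoint irr.
apply: elementary_primitive (irreducible_binomial_coprime u0 irr) => //.
split=> //; first by rewrite expo_diff_eq0.
move=> y y0 Ay; have yE := expo_diff_pos_part y.
have disj_y : disjoint_expo (pos_part y) (pos_part (- y)).
  by move=> j; rewrite !mnmE !mxE; case: ifP; case: ifP; move: (y j 0) => t; lia.
have tory : toric_binomial K D (pos_part y) (pos_part (- y)).
  by apply/toric_binomialP; rewrite -expo_diff_eq0 yE.
case/toric_binomialP: (tory) => uvy _.
have := min _ _ tory; rewrite !supp_vars_binomial //.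
by rewrite -!supp_expo_diff // yE.
Qed.

End ToricBinomials.

(** * Generators of the toric ideal *)

Section Generators.
Variables (K : fieldType) (n m : nat) (D : wograph n m).
Implicit Types (a b u v : 'X_{1..m}) (p q r : {mpoly K[m]}) (S : {mpoly K[m]} -> Prop).

Lemma generated_ideal_base S p : S p -> generated_ideal S p.
Proof.
move=> Sp; exists [:: (1, p)]; split=> [x|]; first by rewrite inE => /eqP ->.
by rewrite big_seq1 mul1r.
Qed.

Lemma generated_idealD S p q :
  generated_ideal S p -> generated_ideal S q -> generated_ideal S (p + q).
Proof.
case=> s [sS ->] [t [tS ->]]; exists (s ++ t); rewrite big_cat; split=> // x.
by rewrite mem_cat => /orP[/sS|/tS].
Qed.

Lemma generated_idealM S r p : generated_ideal S p -> generated_ideal S (r * p).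
Proof.
case=> s [sS ->]; exists [seq (r * x.1, x.2) | x <- s]; split.
  by move=> _ /mapP[x /sS xS ->].
by rewrite big_map mulr_sumr; apply: eq_bigr => x _; rewrite mulrA.
Qed.

Lemma generated_ideal0 S : generated_ideal S 0.
Proof. by exists [::]; split=> //; rewrite big_nil. Qed.

(** A binomial that is not primitive splits into multiples of two binomials of smaller total degree.
    The hypothesis allows [u = v], which can happen for the second of them. *)
Lemma binomial_generated u v : incidence D *m expo_diff u v = 0 ->
  generated_ideal (graver D) (binomial K u v).
Proof.
have [k] := ubnP (mdeg u + mdeg v); elim: k u v => // k IHk u v lt_k Auv.
have [->|uv] := eqVneq u v; first by rewrite /binomial subrr; apply: generated_ideal0.
have tor : toric_binomial K D u v by apply/toric_binomialP.
have [prim|nprim] := classic (primitive K D u v).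
  by apply: generated_ideal_base; exists u, v.
have [u' [v' [tor' le_u le_v ne]]] : exists u' v', [/\ toric_binomial K D u' v',
    (u' <= u)%MM, (v' <= v)%MM & ~ eq_up_to_sign (binomial K u' v') (binomial K u v)].
  apply: NNPP => no; apply: nprim; split=> // u' v' tor' le_u le_v.
  by apply: NNPP => ne; apply: no; exists u', v'.
have [u0 v0] := toric_binomial_neq0 tor'.
have /toric_binomialP[_ A'] := tor'.
have [uE vE] := (submK le_u, submK le_v).
have -> : binomial K u v = 'X_[u - u'] * binomial K u' v'
    + 'X_[v'] * binomial K (u - u')%MM (v - v')%MM.
  rewrite /binomial !mulrBr -!mpolyXD uE [(v' + (v - v'))%MM]addmC vE.
  by rewrite [(v' + (u - u'))%MM]addmC addrA subrK.
have [degu degv] := (congr1 mdeg uE, congr1 mdeg vE); rewrite !mdegD in degu degv.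
have degu' : (0 < mdeg u')%N by rewrite lt0n mdeg_eq0.
apply: generated_idealD; apply: generated_idealM; apply: IHk => //.
- have : (0 < mdeg (u - u') + mdeg (v - v'))%N.
    rewrite lt0n addn_eq0 !mdeg_eq0; apply/negP => /andP[/eqP ud /eqP vd].
    by apply: ne; left; rewrite -uE -vE ud vd !add0m.
  lia.
- lia.
- have -> : expo_diff (u - u')%MM (v - v')%MM = expo_diff u v - expo_diff u' v'.
    apply/matrixP => j l; rewrite !mxE !mnmBE.
    have := mnm_lepP le_u j; have := mnm_lepP le_v j; lia.
  by rewrite mulmxBr Auv A' subr0.
Qed.

(** Monomials map to monomials, so the image of the leading one can only cancel against that of
    another monomial [b] of [p]. Subtracting a multiple of the binomial of [a] and [b] removes [a]
    and adds no monomial. *)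
Lemma toric_ideal_generated p : toric_ideal D p -> generated_ideal (graver D) p.
Proof.
have [k] := ubnP (size (msupp p)); elim: k p => // k IHk p lt_k torp.
have [->|p0] := eqVneq p 0; first exact: generated_ideal0.
pose a := mlead p; have ap : a \in msupp p by apply: mlead_supp.
have [b [bp ba imb]] : exists b, [/\ b \in msupp p, b != a &
    image_expo D b = image_expo D a].
  apply: NNPP => no_b; have := ap; rewrite mcoeff_msupp => /eqP; apply.
  have : (p \mPo [tuple edge_monomial K D j | j < m])@_(image_expo D a) = 0.
    by rewrite torp mcoeff0.
  rewrite comp_mpolyEX raddf_sum (bigD1_seq a) ?msupp_uniq //= big1_seq ?addr0.
    by rewrite mcoeffZ comp_monomial mcoeffX eqxx mulr1.
  move=> b /andP[ba bp]; rewrite mcoeffZ comp_monomial mcoeffX.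
  by case: eqP => [im|_]; [case: no_b; exists b | rewrite mulr0].
pose q := p - p@_a *: binomial K a b.
have torb : toric_ideal D (binomial K a b) by apply/toric_ideal_binomial.
have pE : p = q + (p@_a)%:MP * binomial K a b by rewrite mul_mpolyC subrK.
have Aab : incidence D *m expo_diff a b = 0.
  apply/matrixP => x l; rewrite [l]ord1 incidence_expo_diff imb subrr mxE //.
rewrite pE; apply: generated_idealD; last first.
  by apply: generated_idealM; apply: binomial_generated.
apply: IHk; last by rewrite /toric_ideal comp_mpolyB comp_mpolyZ torp torb scaler0 subr0.
rewrite -ltnS (leq_trans _ lt_k) // ltnS.
have -> : size (msupp p) = (size (rem a (msupp p))).+1.
  by rewrite size_rem // prednK //; case: (msupp p) ap.
rewrite ltnS; apply: uniq_leq_size => // c.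
rewrite mem_rem_uniq ?msupp_uniq // inE => cq; apply/andP; split.
  apply: contraTneq cq => ->; rewrite -mcoeff_eq0 mcoeffB mcoeffZ mcoeffB !mcoeffX.
  by rewrite eqxx (negPf ba) subr0 mulr1 subrr.
apply: contraTT cq => cp; rewrite -mcoeff_eq0 mcoeffB mcoeffZ mcoeffB !mcoeffX.
have [ac bc] : (a == c) = false /\ (b == c) = false.
  by split; apply: contraNF cp => /eqP <-.
by rewrite ac bc subrr mulr0 subr0 mcoeff_eq0.
Qed.

Lemma graver_generates : generates (graver D) (@toric_ideal K n m D).
Proof.
move=> p; split; last exact: toric_ideal_generated.
case=> s [sG ->]; rewrite /toric_ideal raddf_sum big1_seq //= => x /sG.
by case=> u [v [xE [[_ tor] _]]]; rewrite rmorphM /= xE tor mulr0.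
Qed.

Hypothesis meet : forall z y j, elementary D z -> elementary D y ->
  j \in supp z -> j \in supp y -> supp z = supp y.

(** Both difference vectors have the same minimal support and coprime entries, so each is an integer
    multiple of the other. *)
Lemma primitive_meet u v u' v' j : primitive K D u v -> primitive K D u' v' ->
    j \in supp (expo_diff u v) -> j \in supp (expo_diff u' v') ->
  eq_up_to_sign (binomial K u' v') (binomial K u v).
Proof.
move=> prim prim' jz jy.
have [elz ely] := (primitive_elementary meet prim, primitive_elementary meet prim').
have sE := meet elz ely jz jy.
have [[_ Az _] [_ Ay _]] := (elz, ely).
have [zj yj] : expo_diff u v j 0 != 0 /\ expo_diff u' v' j 0 != 0.
  by split; [move: jz | move: jy]; rewrite inE.
have zy : expo_diff u' v' j 0 *: expo_diff u v = expo_diff u v j 0 *: expo_diff u' v'.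
  by apply: (elementary_prop elz Ay _ jz); rewrite sE.
have [k kE] := coprime_entries_multiple (primitive_coprime prim) zj (esym zy).
have [l lE] := coprime_entries_multiple (primitive_coprime prim') yj zy.
have kl : k = 1 \/ k = -1.
  have kl1 : k * l = 1.
    apply: (mulIf yj); rewrite mul1r -mulrA.
    have <- : expo_diff u v j 0 = l * expo_diff u' v' j 0 by rewrite {1}lE [LHS]mxE.
    by rewrite kE [RHS]mxE.
  have : (absz k * absz l == 1)%N by rewrite -abszM kl1.
  by rewrite muln_eq1 => /andP[k1 _]; clear -k1; lia.
have [disj disj'] := (primitive_disjoint prim, primitive_disjoint prim').
have {}kE i : (u' i)%:Z - (v' i)%:Z = k * ((u i)%:Z - (v i)%:Z).
  by have /matrixP/(_ i 0) := kE; rewrite !mxE.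
case: kl => kl; rewrite kl in kE; [left | right].
  have [-> -> //] : u' = u /\ v' = v.
  split; apply/mnmP => i; have := kE i; case: (disj i); case: (disj' i); lia.
have [-> ->] : u' = v /\ v' = u.
  split; apply/mnmP => i; have := kE i; case: (disj i); case: (disj' i); lia.
by rewrite opprB.
Qed.

(** The monomial [u] occurs in some term of any expression of the binomial by elements of [T], so it
    is divisible by a monomial [b] of an element of [T]. As [b] is not 1, the two primitive
    binomials meet and agree up to sign. *)
Lemma graver_strongly_robust : strongly_robust K D.
Proof.
split=> [|T TG Topp genT p [u [v [pE prim]]]]; first exact: graver_generates.
case: (prim) => -[uv0 tor] _; have /toric_binomialP[uv _] := conj uv0 tor.
have [s [sT bE]] := (genT (binomial K u v)).2 tor.
have [/allP all0|/allPn[x xs xu]] :=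
    boolP (all (fun x : {mpoly K[m]} * {mpoly K[m]} => (x.1 * x.2)@_u == 0) s).
  have /negP[] : u \notin msupp (binomial K u v).
    by rewrite -mcoeff_eq0 bE raddf_sum big1_seq //= => x /all0/eqP.
  by rewrite binomial_msupp // inE eqxx.
have Tx := sT x xs; have [u' [v' [xE prim']]] := TG _ Tx.
have [tor' _] := prim'; have /toric_binomialP[uv' _] := tor'.
have [u0 v0] := toric_binomial_neq0 tor'.
rewrite -mcoeff_msupp in xu; have /allpairsP[[a b] /= [_ bx uE]] := msuppM_le xu.
have b0 : b != 0%MM.
  by move: bx; rewrite xE binomial_msupp // !inE => /orP[] /eqP ->.
have /existsP[j bj] : [exists j, b j != 0%N].
  apply: contraNT b0 => /existsPn h; apply/eqP/mnmP => j.
  by have := h j; rewrite negbK mnm0E => /eqP.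
have jz : j \in supp (expo_diff u v).
  rewrite supp_expo_diff; last exact: primitive_disjoint prim.
  by rewrite inE uE mnmDE addn_eq0 negb_and bj orbT.
have jy : j \in supp (expo_diff u' v').
  rewrite supp_expo_diff; last exact: primitive_disjoint prim'.
  by move: bx; rewrite xE binomial_msupp // !inE => /orP[] /eqP <-; rewrite bj ?orbT.
rewrite pE; have := primitive_meet prim prim' jz jy; rewrite -xE.
by case=> [<- // | xN]; rewrite -[binomial _ _ _]opprK -xN; apply: Topp.
Qed.

End Generators.

Theorem theorem3p5 (K : fieldType) (n m : nat) (D : wograph n m)
  (two : at_most_two_unbalanced D)
  (cond_i : forall C1 C2 P B : {set 'I_m},
     exactly_two_unbalanced D C1 C2 -> connects D P C1 C2 ->
     balanced_cycle D B -> ~ share_edge B P)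
  (cond_ii : forall B1 B2 : {set 'I_m},
     balanced_cycle D B1 -> balanced_cycle D B2 -> B1 <> B2 ->
     ~ share_path D B1 B2) :
  (forall f : {mpoly K[m]}, graver D f <-> circuit D f) /\ strongly_robust K D.
Proof.
have meet := elementary_meet two cond_i cond_ii.
split; last exact: graver_strongly_robust.
by move=> f; split; [apply: graver_circuit | apply: circuit_graver].
Qed.
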